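(* Let $\mathbb F_q$ be the finite field with $q$ elements and characteristic $p$. Let $\mathcal K$ be a finite set of positive integers, suppose that $\alpha_r\in \mathbb K_\infty=\mathbb F_q((1/t))$ for $r\in \mathcal K\cup \{0\}$, and define \[ f(x)=\sum_{r\in \mathcal K\cup \{0\}}\alpha_r x^r . \] Suppose that $\alpha_k$ is irrational for some $k\in \mathcal K$ satisfying $p\nmid k$ and furthermore $p^v k\notin \mathcal K$ for every positive integer $v$. Then the sequence $(f(u))_{u\in \mathbb F_q[t]}$ is totally equidistributed in $\mathbb T$.
   Context: $\mathbb K=\mathbb F_q(t)$, and $\mathbb K_\infty=\mathbb F_q((1/t))$ is the field of formal Laurent series $\alpha=\sum_{i\le n}a_it^i$ ($n\in\mathbb Z$, $a_i\in\mathbb F_q$). Put $\mathrm{ord}\,0=-\infty$ and, for $\alpha\neq 0$, $\mathrm{ord}\,\alpha=\max\{i:a_i\ne 0\}$; the absolute value is $|\alpha|=q^{\mathrm{ord}\,\alpha}$. An element $\alpha\in \mathbb K_\infty$ is irrational if $\alpha\notin \mathbb K$. Let $\mathbb T=\{\alpha\in \mathbb K_\infty:\mathrm{ord}\,\alpha<0\}$, a compact group under addition, with Haar measure $\mu$ normalized so that $\mu(\mathbb T)=1$. The fractional part of $\alpha=\sum_{i\le n}a_it^i$ is $\{\alpha\}=\sum_{i\le -1}a_it^i\in \mathbb T$. For a function $f:\mathbb F_q[t]\to \mathbb K_\infty$, the sequence $(f(u))_{u\in \mathbb F_q[t]}$ is equidistributed in $\mathbb T$ if for every open ball $\mathcal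 B\subset \mathbb T$ one has \[ \lim_{N\to\infty}q^{-N}\,\mathrm{card}\{u\in \mathbb F_q[t]:\mathrm{ord}\,u<N \text{ and } \{f(u)\}\in \mathcal B\}=\mu(\mathcal B). \] It is totally equidistributed in $\mathbb T$ if $(f(mu+s))_{u\in \mathbb F_q[t]}$ is equidistributed in $\mathbb T$ for all $m,s\in \mathbb F_q[t]$ with $m\ne 0$. *)

(* Defs.v *)
From HB Require Import structures.
From mathcomp Require Import all_boot all_order all_algebra finmap.
From mathcomp Require Import zify.
From mathcomp Require Import all_classical all_reals all_analysis.

Set Implicit Arguments.
Unset Strict Implicit.
Unset Printing Implicit Defensive.

Import Order.TTheory GRing.Theory Num.Theory.
Import numFieldNormedType.Exports.

Local Open Scope classical_set_scope.
Local Open Scope ring_scope.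

(* [a : laurent F] is the series [\sum_i a i * t ^ i] of F((1/t)): infinitely
   many negative exponents are allowed, but only finitely many positive ones. *)
Definition bounded_above (F : fieldType) (a : int -> F) (n : int) :=
  forall i, n < i -> a i = 0.

Record laurent (F : fieldType) := Laurent {
  lcoef :> int -> F;
  lcoef_bounded : exists n, bounded_above lcoef n }.

HB.instance Definition _ (F : fieldType) := gen_eqMixin (laurent F).
HB.instance Definition _ (F : fieldType) := gen_choiceMixin (laurent F).

Section LaurentField.
Variable F : fieldType.
Implicit Types (a b c : laurent F) (n m i j k : int).

Lemma laurentP a b : (a : int -> F) =1 b -> a = b.
Proof.
case: a b => [a Ha] [b Hb] /= /funext ab; subst b.
by rewrite (Prop_irrelevance Ha Hb).
Qed.

Fact lzero_subproof : exists n, bounded_above (fun=> 0 : F) n.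
Proof. by exists 0. Qed.
Definition lzero := Laurent lzero_subproof.

Fact lone_subproof : exists n, bounded_above (fun i => (i == 0)%:R : F) n.
Proof. by exists 0 => i; case: eqP => // ->. Qed.
Definition lone := Laurent lone_subproof.

Fact lopp_subproof a : exists n, bounded_above (fun i => - a i) n.
Proof.
by case: (lcoef_bounded a) => n an; exists n => i /an ->; rewrite oppr0.
Qed.
Definition lopp a := Laurent (lopp_subproof a).

Fact ladd_subproof a b : exists n, bounded_above (fun i => a i + b i) n.
Proof.
case: (lcoef_bounded a) (lcoef_bounded b) => n an [m bm].
exists (Num.max n m) => i; rewrite gt_max => /andP[/an -> /bm ->].
exact: addr0.
Qed.
Definition ladd a b := Laurent (ladd_subproof a b).

Lemma lmul_bounded (a b : int -> F) n m :
  bounded_above a n -> bounded_above b m ->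
  bounded_above (fun k => \sum_(i \in [set: int]) a i * b (k - i)) (n + m).
Proof.
move=> an bm k nmk; apply: fsbig1 => i _.
have [/an ->|ni] := ltP n i; first by rewrite mul0r.
by rewrite bm ?mulr0// ltrBrDr addrC (le_lt_trans _ nmk)// lerD2r.
Qed.

Fact lmul_subproof a b :
  exists n, bounded_above
    (fun k => \sum_(i \in [set: int]) a i * b (k - i)) n.
Proof.
case: (lcoef_bounded a) (lcoef_bounded b) => n an [m bm].
by exists (n + m); exact: lmul_bounded.
Qed.
(* the sum has finite support for every k *)
Definition lmul a b := Laurent (lmul_subproof a b).

Let laddA : associative ladd.
Proof. by move=> a b c; apply: laurentP => i /=; rewrite addrA. Qed.
Let laddC : commutative ladd.
Proof. by move=> a b; apply: laurentP => i /=; rewrite addrC. Qed.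
Let ladd0 : left_id lzero ladd.
Proof. by move=> a; apply: laurentP => i /=; rewrite add0r. Qed.
Let laddN : left_inverse lzero lopp ladd.
Proof. by move=> a; apply: laurentP => i /=; rewrite addNr. Qed.

HB.instance Definition _ :=
  GRing.isZmodule.Build (laurent F) laddA laddC ladd0 laddN.

Definition ltrunc n N (a : int -> F) : {poly F} :=
  \poly_(j < N) a (n - j%:Z).

Lemma coef_lmul a b n m (l N : nat) :
  bounded_above a n -> bounded_above b m -> (l < N)%N ->
  lmul a b (n + m - l%:Z) = (ltrunc n N a * ltrunc m N b)`_l.
Proof.
move=> an bm lN; rewrite coefM /=.
transitivity (\sum_(j < l.+1) a (n - j%:Z) * b (m - (l - j)%N%:Z)); last first.
  apply: eq_bigr => j _; rewrite !coef_poly.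
  have jN : (j < N)%N by apply: leq_ltn_trans lN; rewrite -ltnS.
  have ljN : (l - j < N)%N by apply: leq_ltn_trans lN; exact: leq_subr.
  by rewrite jN ljN.
pose h (j : nat) : int := n - j%:Z.
have injh : {in `I_l.+1 &, injective h}.
  by move=> x y _ _ /addrI /oppr_inj [].
rewrite (@fsbig_ord _ _ _ l.+1 (fun j : nat => a (n - j%:Z) * b (m - (l - j)%N%:Z))).
rewrite -(fsbig_widen (h @` `I_l.+1))//; last first.
  move=> i /= [_ NI]; have [/an ->|ni] := ltP n i; first by rewrite mul0r.
  rewrite bm ?mulr0// ltNge; apply/negP => le.
  by apply: NI; exists (`|n - i|%N); rewrite /h /=; lia.
rewrite fsbig_image//; apply: eq_fsbigr => j /=; rewrite inE /= ltnS => jl.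
by congr (_ * b _); rewrite /h; lia.
Qed.

Lemma laurent_eqP a b n : bounded_above a n -> bounded_above b n ->
  (forall l : nat, a (n - l%:Z) = b (n - l%:Z)) -> a = b.
Proof.
move=> an bn ab; apply: laurentP => i.
have [ni|ni] := ltP n i; first by rewrite an// bn.
by have := ab `|n - i|%N; rewrite gez0_abs ?subr_ge0// subKr.
Qed.

Lemma coef_ltrunc n N (a : int -> F) (l : nat) :
  (l < N)%N -> (ltrunc n N a)`_l = a (n - l%:Z).
Proof. by move=> lN; rewrite coef_poly lN. Qed.

Lemma coefM_low (p p' q : {poly F}) (l : nat) :
  (forall k : nat, (k <= l)%N -> p`_k = p'`_k) -> (p * q)`_l = (p' * q)`_l.
Proof.
by move=> pp'; rewrite !coefM; apply: eq_bigr => j _; rewrite pp'// -ltnS.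
Qed.

Lemma lmulC : commutative lmul.
Proof.
move=> a b; case: (lcoef_bounded a) (lcoef_bounded b) => n an [m bm].
apply: (@laurent_eqP _ _ (n + m)); first exact: lmul_bounded.
  by rewrite addrC; exact: lmul_bounded.
move=> l; rewrite (coef_lmul an bm (ltnSn l)) [n + m]addrC.
by rewrite (coef_lmul bm an (ltnSn l)) mulrC.
Qed.

Lemma lmulA : associative lmul.
Proof.
suff H a b c n m k : bounded_above a n -> bounded_above b m ->
    bounded_above c k -> forall l : nat,
    lmul (lmul a b) c (n + m + k - l%:Z) =
    (ltrunc n l.+1 a * ltrunc m l.+1 b * ltrunc k l.+1 c)`_l.
  move=> a b c; case: (lcoef_bounded a) => n an.
  case: (lcoef_bounded b) => m bm; case: (lcoef_bounded c) => k ck.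
  apply: (@laurent_eqP _ _ (n + m + k)) => [||l].
  - by rewrite -addrA; do 2 apply: lmul_bounded => //.
  - by do 2 apply: lmul_bounded => //.
  - rewrite [RHS](H _ _ _ n m k)// lmulC (_ : n + m + k = m + k + n); last lia.
    by rewrite H// mulrC mulrA.
move=> an bm ck l.
rewrite (coef_lmul _ ck (ltnSn l)); last exact: lmul_bounded.
apply: coefM_low => j jl; rewrite coef_ltrunc//.
exact: coef_lmul.
Qed.

Lemma lmul1 : left_id lone lmul.
Proof.
move=> a; case: (lcoef_bounded a) => m am.
have b1 : bounded_above lone 0 by move=> i /=; case: eqP => // ->.
apply: (@laurent_eqP _ _ m) => // [|l].
  by rewrite -[m]add0r; exact: lmul_bounded.
rewrite -[m in LHS]add0r (coef_lmul b1 am (ltnSn l)).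
rewrite -(coef_ltrunc _ _ (ltnSn l)) -[in RHS](mul1r (ltrunc _ _ _)).
apply: coefM_low => k kl; rewrite coef_ltrunc// coef1 /=.
by rewrite sub0r oppr_eq0.
Qed.

Lemma lmulDl : left_distributive lmul ladd.
Proof.
move=> a b c.
case: (lcoef_bounded a) (lcoef_bounded b) => n0 an0 [m0 bm0].
pose n := Num.max n0 m0.
have an : bounded_above a n by move=> i; rewrite gt_max => /andP[/an0].
have bn : bounded_above b n by move=> i; rewrite gt_max => /andP[_ /bm0].
have abn : bounded_above (ladd a b) n.
  by move=> i ni /=; rewrite an// bn// addr0.
case: (lcoef_bounded c) => k ck.
apply: (@laurent_eqP _ _ (n + k)) => [||l]; first exact: lmul_bounded.
  move=> i ni /=.
  by rewrite (lmul_bounded an ck ni) (lmul_bounded bn ck ni) addr0.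
transitivity (lmul a c (n + k - l%:Z) + lmul b c (n + k - l%:Z)) => //.
rewrite (coef_lmul abn ck (ltnSn l)) (coef_lmul an ck (ltnSn l)).
rewrite (coef_lmul bn ck (ltnSn l)) -coefD -mulrDl.
apply: coefM_low => j jl; rewrite coefD !coef_ltrunc//.
Qed.

Lemma lone_neq0 : lone != 0.
Proof.
apply/eqP => /(congr1 (fun a : laurent F => a 0)) /= /eqP.
by rewrite oner_eq0.
Qed.

HB.instance Definition _ := GRing.Zmodule_isComNzRing.Build (laurent F)
  lmulA lmulC lmul1 lmulDl lone_neq0.

Lemma laurent_lead a : a != 0 -> exists n, a n != 0 /\ bounded_above a n.
Proof.
move=> a0; case: (lcoef_bounded a) => n an.
have ex : exists l : nat, a (n - l%:Z) != 0.
  apply: contrapT => nex; case/eqP: a0.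
  apply: (@laurent_eqP _ _ n) => // l.
  by apply/eqP; rewrite -[_ == _]negbK; apply/negP => al; apply: nex; exists l.
case: (ex_minnP ex) => l al lmin; exists (n - l%:Z); split=> // i li.
have [ni|ni] := ltP n i; first exact: an.
apply/eqP; rewrite -[_ == _]negbK; apply/negP => ai.
have := lmin `|n - i|%N; rewrite gez0_abs ?subr_ge0// subKr => /(_ ai).
rewrite -lez_nat gez0_abs ?subr_ge0// lerBrDr addrC -lerBrDr.
by rewrite leNgt li.
Qed.

Lemma series_inv (c : nat -> F) : c 0%N != 0 -> exists d : nat -> F,
  forall l, \sum_(j < l.+1) c j * d (l - j)%N = (l == 0%N)%:R.
Proof.
move=> c0.
pose step s := rcons s ((c 0%N)^-1 * ((size s == 0%N)%:R
  - \sum_(j < size s) c j.+1 * s`_(size s - j.+1))).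
pose S l := iter l step [::].
have sS l : size (S l) = l by elim: l => //= l IH; rewrite size_rcons IH.
pose d l := (S l.+1)`_l.
have Sd (l k : nat) : (k < l)%N -> (S l)`_k = d k.
  elim: l => // l IH; rewrite ltnS leq_eqVlt => /orP[/eqP->//|kl].
  by rewrite /S /= nth_rcons sS kl IH.
exists d => l; rewrite big_ord_recl /= subn0 {1}/d /S /= nth_rcons.
rewrite -/(S l) !sS ltnn eqxx mulrA divff// mul1r.
rewrite (eq_bigr (fun j : 'I_l => c j.+1 * d (l - j.+1)%N)).
  by rewrite subrK.
by move=> j _; rewrite Sd// ltn_subrL /=; case: (l) j => [[]|].
Qed.

Definition linv a : laurent F := xget 0 [set b : laurent F | b * a = 1].

Lemma lmulV a : a != 0 -> linv a * a = 1.
Proof.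
move=> a0; rewrite /linv; case: xgetP => // nob.
have [n [an bn]] := laurent_lead a0.
have [|d Hd] := @series_inv (fun j : nat => a (n - j%:Z)); first by rewrite subr0.
have bb : bounded_above (fun i => if i <= - n then d `|- n - i|%N else 0) (- n).
  by move=> i; rewrite ltNge => /negbTE ->.
pose b := Laurent (ex_intro _ _ bb).
exfalso; apply: (nob b) => /=; rewrite mulrC.
apply: (@laurent_eqP _ _ 0) => [||l].
- by rewrite -[0](subrr n); exact: lmul_bounded.
- by move=> i /=; case: eqP => // ->.
rewrite -{1}(subrr n) (@coef_lmul a b _ _ l _ bn bb (ltnSn l)) coefM /=.
rewrite sub0r oppr_eq0 -[RHS]Hd; apply: eq_bigr => j _.
rewrite (coef_ltrunc n a (ltn_ord j)) coef_ltrunc ?ltnS ?leq_subr//.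
rewrite /= ifT; last by have := ltn_ord j; lia.
by congr (_ * d _); lia.
Qed.

Lemma linv0 : linv 0 = 0.
Proof.
rewrite /linv; case: xgetP => // b _ /= /eqP.
by rewrite mulr0 eq_sym oner_eq0.
Qed.

HB.instance Definition _ := GRing.ComNzRing_isField.Build (laurent F)
  lmulV linv0.

End LaurentField.

Section LaurentOrd.
Variable F : fieldType.
Implicit Types (a b : laurent F) (u : {poly F}) (n : int).

Fact lpoly_subproof u :
  exists n, bounded_above (fun i : int => if i is Posz j then u`_j else 0) n.
Proof.
exists (size u)%:Z => -[j|//] uj; rewrite nth_default//.
by apply: ltnW; rewrite -ltz_nat.
Qed.
(* the embedding of F[t] into F((1/t)), ['X] being sent to t *)
Definition lpoly u := Laurent (lpoly_subproof u).

Definition lrational a :=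
  exists P Q : {poly F}, Q != 0 /\ a = lpoly P / lpoly Q.

Definition lirrational a := ~ lrational a.

Definition lord a : \bar int :=
  if a == 0 then -oo%E
  else (xget 0 [set n | a n != 0 /\ bounded_above a n])%:E.

Lemma lord_ltP a n : (lord a < n%:E)%E <-> forall i, n <= i -> a i = 0.
Proof.
rewrite /lord; case: eqVneq => [->|a0]; first by rewrite ltNyr; split.
case: xgetP => [m _ [am mb]|nom]; last first.
  by have [m am] := laurent_lead a0; case: (nom m).
rewrite lte_fin; split=> [mn i ni|H]; first by apply: mb; exact: lt_le_trans ni.
by rewrite ltNge; apply/negP => nm; rewrite H ?eqxx in am.
Qed.

Definition in_torus : pred (laurent F) := fun a => (lord a < 0)%E.

Record torus := Torus { tor_val :> laurent F; _ : in_torus tor_val }.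

HB.instance Definition _ := [isSub for tor_val].
HB.instance Definition _ := [Choice of torus by <:].

Fact torus_zmod_closed : zmod_closed in_torus.
Proof.
split=> [|a b]; rewrite /in_torus !unfold_in; first exact/lord_ltP.
move=> /lord_ltP a0 /lord_ltP b0; apply/lord_ltP => i i0.
by rewrite /= a0// b0// subrr.
Qed.
HB.instance Definition _ :=
  GRing.isZmodClosed.Build (laurent F) in_torus torus_zmod_closed.
HB.instance Definition _ := [SubChoice_isSubZmodule of torus by <:].
HB.instance Definition _ := isPointed.Build torus 0.

Fact lfrac_subproof a :
  exists n, bounded_above (fun i : int => if i < 0 then a i else 0) n.
Proof. by exists 0 => i i0; rewrite ltNge (ltW i0). Qed.

Fact lfrac_lord a : in_torus (Laurent (lfrac_subproof a)).
Proof. by apply/lord_ltP => i /=; rewrite leNgt => /negbTE ->. Qed.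
Definition lfrac a := Torus (lfrac_lord a).

(* The topology of the ultrametric |x - y| = q ^ lord (x - y); as the positive
   values of this metric are powers of q, balls of radius q ^ n are enough. *)
Definition torus_open : set (set torus) :=
  [set A | forall x : torus, A x ->
     exists n, forall y : torus, (lord (y - x)%R < n%:E)%E -> A y].

Let torus_openT : torus_open setT.
Proof. by move=> x _; exists 0. Qed.

Let torus_openI : setI_closed torus_open.
Proof.
move=> A B oA oB x [/oA [n An] /oB [m Bm]].
exists (Num.min n m) => y yx; split; [apply: An|apply: Bm];
  by apply: lt_le_trans yx _; rewrite lee_fin ge_min lexx ?orbT.
Qed.

Let torus_open_bigU (I : Type) (A : I -> set torus) :
  (forall i, torus_open (A i)) -> torus_open (\bigcup_i A i).
Proof.
move=> oA x [i _ /oA [n An]]; exists n => y /An Ay.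
by exists i.
Qed.

HB.instance Definition _ :=
  isOpenTopological.Build torus torus_openT torus_openI torus_open_bigU.

End LaurentOrd.

Section Equidistribution.
Variables (R : realType) (F : finFieldType).

Definition labs (a : laurent F) : R :=
  if lord a is EFin n then #|F|%:R ^ n else 0.

Definition torus_ball (c : torus F) (r : R) : set (torus F) :=
  [set x | labs (x - c) < r].

Lemma open_torusP (A : set (torus F)) :
  open A <-> forall x, A x -> exists2 r : R, 0 < r & torus_ball x r `<=` A.
Proof.
have q1 : 1 < #|F|%:R :> R by rewrite ltr1n card_finNzRing_gt1.
have q0 : 0 < #|F|%:R :> R by exact: lt_trans q1.
have labs_lt (a : laurent F) (n : int) :
    (labs a < #|F|%:R ^ n) = (lord a < n%:E)%E.
  rewrite /labs /lord; case: eqVneq => _; first by rewrite exprz_gt0// ltNyr.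
  by rewrite lte_fin ltr_eXz2l.
transitivity (torus_open A) => //; split=> oA x /oA.
  move=> [n An]; exists (#|F|%:R ^ n); first exact: exprz_gt0.
  by move=> y; rewrite /torus_ball /= labs_lt; exact: An.
move=> [r r0 rA]; have [n nr] : exists n : nat, #|F|%:R ^- n < r.
  exists (Num.truncn r^-1).+1; rewrite invf_plt ?posrE ?exprn_gt0//.
  apply: (lt_trans (truncnS_gt _)).
  by rewrite -natrX ltr_nat; apply: ltn_expl; rewrite card_finNzRing_gt1.
exists (- n%:Z) => y; rewrite -labs_lt => yx; apply: rA.
by apply: lt_trans yx _; rewrite -exprnN.
Qed.

Definition borel_torus := g_sigma_algebraType (@open (torus F)).

Definition normalized_haar (mu : {measure set borel_torus -> \bar R}) :=
  mu setT = 1%E /\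
  forall (x : torus F) (A : set (torus F)), measurable (A : set borel_torus) ->
    mu [set x + y | y in A] = mu A.

Definition equidistributed (mu : {measure set borel_torus -> \bar R})
    (f : {poly F} -> laurent F) :=
  forall (c : torus F) (r : R), 0 < r ->
  (#|F|%:R ^- N * #|` fset_set [set u : {poly F} |
      (lord (lpoly u) < N%:Z%:E)%E /\ torus_ball c r (lfrac (f u))] |%:R)%:E
    @[N --> \oo] --> mu (torus_ball c r).

Definition totally_equidistributed (mu : {measure set borel_torus -> \bar R})
    (f : {poly F} -> laurent F) :=
  forall m s : {poly F}, m != 0 -> equidistributed mu (fun u => f (m * u + s)).

End Equidistribution.

(* Main.v *)
Require Import Defs.
From HB Require Import structures.
From mathcomp Require Import all_boot all_order all_algebra finmap.
From mathcomp Require Import zify ring.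
From mathcomp Require Import all_classical all_reals all_analysis.

Set Implicit Arguments.
Unset Strict Implicit.
Unset Printing Implicit Defensive.

Import Order.TTheory GRing.Theory Num.Theory.
Import numFieldNormedType.Exports.
Local Open Scope classical_set_scope.
Local Open Scope ring_scope.

(** Weyl differencing in characteristic [p], organised by the base-[p] digit sum
    [s]. Since ['C(r, j)] is prime to [p] exactly when [s r = s j + s (r - j)],
    differencing lowers the digit sums of all exponents. It is enough to test
    with additive characters of [F] that are trivial on [{z ^ p - z}]; for these,
    [res (a * u ^ (j * p ^ v))] and [res (C ^ v (a) * u ^ j)], with [C] the
    Cartier operator, are the same, so that the exponents [j * p ^ v] merge into
    one term, with coefficient [gamma_j = \sum_v C ^ v (a_(j * p ^ v))].

    If [k] has the largest digit sum among the exponents with [gamma_k]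
    irrational, the terms of larger digit sum are periodic and can be removed.
    Differencing by [h] then leads to [j = k - p ^ i], whose coefficient is a
    [p]-semilinear form in [h]; it is irrational on the differences of
    arbitrarily large families of [h], and van der Corput's inequality reduces
    to a smaller digit sum, down to linear polynomials. *)

(** * Base-[p] digit sums and Kummer's theorem on binomial coefficients *)

Section DigitSum.
Local Open Scope nat_scope.
Variable p : nat.
Hypothesis p_prime : prime p.

Let p_gt1 : (1 < p)%N. Proof. exact: prime_gt1. Qed.
Let p_gt0 : (0 < p)%N. Proof. exact: prime_gt0. Qed.

(* By Legendre's formula this is the sum of the base-p digits of n. *)
Definition digit_sum n := (n - p.-1 * logn p n`!)%N.

(** Only the [a] multiples of [p] among the factors of this factorial count; dividing each of them
    by [p] leaves the factorial of [a]. *)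
Lemma logn_fact_mulD a c : (c < p)%N ->
  logn p (p * a + c)`! = (a + logn p a`!)%N.
Proof.
have logn_mulp b : logn p (p * b)`! = (b + logn p b`!)%N.
  elim: b => [|b IH]; first by rewrite muln0.
  rewrite mulnS addnC.
  have H d : (d < p)%N -> logn p (p * b + d)`! = (b + logn p b`!)%N.
    elim: d => [|d IHd] dp; first by rewrite addn0.
    rewrite addnS factS lognM ?fact_gt0// IHd ?(ltn_trans _ dp)//.
    rewrite logn_coprime ?add0n// prime_coprime// -addnS.
    by rewrite dvdn_addr ?dvdn_mulr// gtnNdvd.
  have Ep : (p * b + p = (p * b + p.-1).+1)%N by rewrite -addnS prednK.
  rewrite Ep factS lognM ?fact_gt0// H ?prednK//.
  rewrite -Ep -mulnSr lognM// logn_prime// eqxx factS lognM ?fact_gt0//; lia.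
elim: c => [|c IHc] cp; first by rewrite addn0.
rewrite addnS factS lognM ?fact_gt0// IHc ?(ltn_trans _ cp)//.
rewrite logn_coprime ?add0n// prime_coprime// -addnS.
by rewrite dvdn_addr ?dvdn_mulr// gtnNdvd.
Qed.

Lemma digit_decomp n : n = (p * (n %/ p) + n %% p)%N.
Proof. by rewrite {1}(divn_eq n p) mulnC. Qed.

(** The subtraction in [digit_sum] is truncated; this identity shows that nothing is lost there. *)
Lemma digit_sum_legendre n : n = (digit_sum n + p.-1 * logn p n`!)%N.
Proof.
rewrite subnK//; elim/ltn_ind: n => n IH.
have [->//|n0] := posnP n; first by rewrite fact0 logn1 muln0.
rewrite {1}[n]digit_decomp logn_fact_mulD ?ltn_pmod//.
have := IH (n %/ p) (ltn_Pdiv p_gt1 n0); have := divn_eq n p; nia.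
Qed.

Lemma digit_sumMD a c : (c < p)%N ->
  digit_sum (p * a + c) = (digit_sum a + c)%N.
Proof.
move=> cp; have := digit_sum_legendre (p * a + c).
by have := digit_sum_legendre a; rewrite logn_fact_mulD//; nia.
Qed.

Lemma digit_sum0 : digit_sum 0 = 0%N.
Proof. by []. Qed.

Lemma digit_sumMp a : digit_sum (p * a) = digit_sum a.
Proof. by rewrite -[(p * a)%N]addn0 digit_sumMD// addn0. Qed.

Lemma digit_sumMX a v : digit_sum (a * p ^ v) = digit_sum a.
Proof.
elim: v => [|v IH]; first by rewrite muln1.
by rewrite expnS mulnCA digit_sumMp.
Qed.

Lemma digit_sum_eq0 n : (digit_sum n == 0%N) = (n == 0%N).
Proof.
apply/eqP/eqP => [|->//]; elim/ltn_ind: n => n IH s0.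
have [->//|n0] := posnP n.
move: s0; rewrite {1}[n]digit_decomp digit_sumMD ?ltn_pmod//.
move=> /eqP; rewrite addn_eq0 => /andP[/eqP s0 /eqP m0].
have := IH _ (ltn_Pdiv p_gt1 n0) s0 => d0.
by rewrite [n]digit_decomp d0 m0 muln0.
Qed.

Lemma digit_sum_eq1 n : digit_sum n = 1%N -> exists i, n = (p ^ i)%N.
Proof.
elim/ltn_ind: n => n IH s1; have [n0|n0] := posnP n; first by move: s1; rewrite n0.
move: s1; rewrite {1}[n]digit_decomp digit_sumMD ?ltn_pmod// => s1.
have [m0|m0] := posnP (n %% p).
  move: s1; rewrite m0 addn0 => /(IH _ (ltn_Pdiv p_gt1 n0)) [i Ei].
  by exists i.+1; rewrite [n]digit_decomp m0 addn0 Ei expnS.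
have /eqP : digit_sum (n %/ p) = 0%N by lia.
rewrite digit_sum_eq0 => /eqP d0; exists 0%N.
rewrite [n]digit_decomp d0 muln0 add0n expn0; move: s1; rewrite d0 digit_sum0; lia.
Qed.

Lemma digit_sum1 : digit_sum 1 = 1%N.
Proof. by have := digit_sumMD 0 p_gt1; rewrite muln0 add0n. Qed.

Lemma digit_sumX i : digit_sum (p ^ i) = 1%N.
Proof. by rewrite -[(p ^ i)%N]mul1n digit_sumMX digit_sum1. Qed.

Lemma digit_sum_subX n : (0 < n)%N ->
  exists i, (p ^ i <= n)%N /\ digit_sum n = (digit_sum (n - p ^ i)).+1.
Proof.
elim/ltn_ind: n => n IH n0; have [m0|m0] := posnP (n %% p).
  have En : n = (p * (n %/ p))%N by rewrite {1}[n]digit_decomp m0 addn0.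
  have d0 : (0 < n %/ p)%N by rewrite lt0n; apply: contraTneq n0 => d0; rewrite En d0 muln0.
  have [i [le_i Ei]] := IH _ (ltn_Pdiv p_gt1 n0) d0.
  exists i.+1; rewrite expnS En leq_pmul2l// -mulnBr !digit_sumMp.
  by split.
exists 0%N; rewrite expn0 n0; split=> //.
rewrite {1}[n]digit_decomp digit_sumMD ?ltn_pmod//.
have -> : (n - 1 = p * (n %/ p) + (n %% p).-1)%N.
  by rewrite {1}[n]digit_decomp -addnBA// subn1.
have := ltn_pmod n p_gt0; move=> mp; rewrite digit_sumMD; lia.
Qed.

(** The last digit has to stay nonzero. If it is [1], a unit is taken from a higher digit, which
    exists because the digit sum exceeds [1]; otherwise the last digit itself is lowered. *)
Lemma digit_sum_subX_coprime k : ~~ (p %| k) -> (1 < digit_sum k)%N ->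
  exists i, [/\ (p ^ i <= k)%N, ~~ (p %| k - p ^ i) &
    digit_sum k = (digit_sum (k - p ^ i)).+1].
Proof.
rewrite /dvdn -lt0n => m0 s1; have mp := ltn_pmod k p_gt0.
have [m1|m1] := leqP (k %% p) 1.
  have Em : k %% p = 1%N by lia.
  have Ek : k = (p * (k %/ p) + 1)%N by rewrite -Em -digit_decomp.
  have d0 : (0 < k %/ p)%N.
    rewrite lt0n; apply: contraTneq s1 => d0.
    by rewrite Ek d0 muln0 add0n digit_sum1.
  have [i [le_i Ei]] := digit_sum_subX d0; exists i.+1.
  have le : (p ^ i.+1 <= p * (k %/ p))%N by rewrite expnS leq_pmul2l.
  have Es : (k - p ^ i.+1 = p * (k %/ p - p ^ i) + 1)%N.
    by rewrite {1}Ek mulnBr -expnS; lia.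
  split; first by lia.
    by rewrite Es -lt0n mulnC modnMDl modn_small.
  by rewrite Es {1}Ek !digit_sumMD// Ei addSn.
exists 0%N; rewrite expn0.
have Es : (k - 1 = p * (k %/ p) + (k %% p).-1)%N.
  by rewrite {1}[k]digit_decomp -addnBA// subn1.
split; first exact: leq_trans m0 (leq_mod _ _).
  rewrite Es mulnC modnMDl modn_small; first by rewrite -lt0n -ltnS prednK.
  by apply: leq_ltn_trans mp; exact: leq_pred.
rewrite Es {1}[k]digit_decomp !digit_sumMD//; last by apply: leq_ltn_trans mp; exact: leq_pred.
by rewrite -addnS prednK// (ltn_trans _ m1).
Qed.

(** Kummer's theorem: Legendre's formula is applied to the three factorials of [bin_fact], and the
    linear terms cancel. *)
Lemma logn_bin_digit_sum r j : (j <= r)%N ->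
  (digit_sum j + digit_sum (r - j) = digit_sum r + p.-1 * logn p 'C(r, j))%N.
Proof.
move=> jr; have := congr1 (logn p) (bin_fact jr).
rewrite !lognM ?muln_gt0 ?bin_gt0 ?fact_gt0//.
have := digit_sum_legendre r; have := digit_sum_legendre j.
have := digit_sum_legendre (r - j); nia.
Qed.

Lemma ndvdn_bin r j : (j <= r)%N ->
  ~~ (p %| 'C(r, j)) <-> digit_sum r = (digit_sum j + digit_sum (r - j))%N.
Proof.
move=> jr; have E := logn_bin_digit_sum jr.
have -> : (p %| 'C(r, j)) = (0 < logn p 'C(r, j))%N.
  by rewrite logn_gt0 mem_primes p_prime bin_gt0 jr.
by rewrite -leqNgt; split; nia.
Qed.

End DigitSum.

(** * Polynomials inside Laurent series, rationality and residues *)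

Section LaurentPolynomials.
Variable F : fieldType.
Implicit Types (a b : laurent F) (u v : {poly F}).

Lemma lcoefB a b i : (a - b) i = a i - b i.
Proof. by []. Qed.

Lemma lcoef_sum (I : Type) (r : seq I) (P : pred I) (G : I -> laurent F) i :
  (\sum_(x <- r | P x) G x) i = \sum_(x <- r | P x) G x i.
Proof. by elim/big_rec2: _ => // x y z _ <-. Qed.

Lemma lcoef_lpolyM u a k :
  (lpoly u * a) k = \sum_(j < size u) u`_j * a (k - j%:Z).
Proof.
transitivity (\sum_(i \in [set: int]) lpoly u i * a (k - i)) => //.
rewrite (@fsbig_ord _ _ _ _ (fun j : nat => u`_j * a (k - j%:Z))).
rewrite -(fsbig_widen (Posz @` `I_(size u))%classic)//; last first.
  move=> [j|j] /= [_ NI]; last by rewrite mul0r.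
  by rewrite nth_default ?mul0r// leqNgt; apply/negP => ju; apply: NI; exists j.
by rewrite fsbig_image// => x y _ _ [].
Qed.

Lemma lcoef_lpolyCM c a k : (lpoly c%:P * a) k = c * a k.
Proof.
rewrite lcoef_lpolyM size_polyC; case: eqVneq => [->|c0].
  by rewrite big_ord0 mul0r.
by rewrite big_ord1 coefC eqxx subr0.
Qed.

Lemma lcoef_lpolyXM a k : (lpoly 'X * a) k = a (k - 1).
Proof.
rewrite lcoef_lpolyM size_polyX 2!big_ord_recl big_ord0.
by rewrite /= !coefX /= mul0r mul1r add0r addr0.
Qed.

Let lpolyB : zmod_morphism (@lpoly F).
Proof. by move=> u v; apply: laurentP => -[j|j]; rewrite lcoefB/= ?coefB ?subr0. Qed.

HB.instance Definition _ :=
  GRing.isZmodMorphism.Build {poly F} (laurent F) (@lpoly F) lpolyB.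

Let lpoly_monoid_morphism : monoid_morphism (@lpoly F).
Proof.
split=> [|u v].
  by apply: laurentP => -[j|j] //=; rewrite coef1.
elim/poly_ind: u v => [|u c IH] v; first by rewrite mul0r raddf0 mul0r.
have lpolyX (w : {poly F}) : lpoly ('X * w) = lpoly 'X * lpoly w.
  apply: laurentP => k; rewrite lcoef_lpolyXM.
  by case: k => [[|j]|j] //=; rewrite coefXM //= subn1.
have lpolyC (w : {poly F}) : lpoly (c%:P * w) = lpoly c%:P * lpoly w.
  apply: laurentP => k; rewrite lcoef_lpolyCM.
  by case: k => [j|j] /=; rewrite ?coefCM ?mulr0.
rewrite mulrDl -mulrA !raddfD /= IH lpolyX lpolyC IH mulrDl mulrA; congr (_ * _ + _).
Qed.

HB.instance Definition _ :=
  GRing.isMonoidMorphism.Build {poly F} (laurent F) (@lpoly F)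
    lpoly_monoid_morphism.

Lemma lcoef_lpolyXnM n a k : (lpoly 'X^n * a) k = a (k - n%:Z).
Proof.
elim: n a k => [|n IH] a k; first by rewrite expr0 rmorph1 mul1r subr0.
rewrite exprS rmorphM -mulrA lcoef_lpolyXM IH; congr (a _); lia.
Qed.

Lemma lpoly_eq0 u : (lpoly u == 0) = (u == 0).
Proof.
apply/eqP/eqP => [u0|->]; last exact: rmorph0.
by apply/polyP => i; have := congr1 (fun a : laurent F => a i) u0; rewrite coef0.
Qed.

Lemma lrational_poly u : lrational (lpoly u).
Proof. by exists u, 1; rewrite oner_neq0 rmorph1 divr1. Qed.

Lemma lrational0 : lrational (0 : laurent F).
Proof. by rewrite -(rmorph0 (@lpoly F)); exact: lrational_poly. Qed.

Lemma lrationalN a : lrational a -> lrational (- a).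
Proof.
by move=> [P [Q [Q0 ->]]]; exists (- P), Q; rewrite rmorphN mulNr.
Qed.

Lemma lrationalD a b : lrational a -> lrational b -> lrational (a + b).
Proof.
move=> [P [Q [Q0 ->]]] [S [T [T0 ->]]].
exists (P * T + S * Q), (Q * T); rewrite mulf_neq0//; split=> //.
by rewrite addf_div ?lpoly_eq0// rmorphD !rmorphM.
Qed.

Lemma lrationalB a b : lrational a -> lrational b -> lrational (a - b).
Proof. by move=> ra /lrationalN; exact: lrationalD. Qed.

Lemma lrational_sum (I : Type) (r : seq I) (P : pred I) (G : I -> laurent F) :
  (forall i, P i -> lrational (G i)) -> lrational (\sum_(i <- r | P i) G i).
Proof.
move=> rG; elim/big_ind: _ => //; [exact: lrational0|exact: lrationalD].
Qed.

Lemma lrationalM a b : lrational a -> lrational b -> lrational (a * b).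
Proof.
move=> [P [Q [Q0 ->]]] [S [T [T0 ->]]].
exists (P * S), (Q * T); rewrite mulf_neq0//; split=> //.
by rewrite mulf_div !rmorphM.
Qed.

Lemma lrational_polyMl u a : u != 0 -> lrational (lpoly u * a) -> lrational a.
Proof.
move=> u0 [P [Q [Q0 E]]]; exists P, (u * Q); rewrite mulf_neq0//; split=> //.
rewrite rmorphM invfM mulrCA -E mulrA mulVf ?mul1r ?lpoly_eq0//.
Qed.

(* Lagrange interpolation inverts the Vandermonde system with nodes [x d]. *)
Lemma lrational_vandermonde n (x : 'I_n -> {poly F}) (g : 'I_n -> laurent F) :
  injective x ->
  (forall e, (e < n)%N -> lrational (\sum_d lpoly (x d) ^+ e * g d)) ->
  forall d, lrational (g d).
Proof.
move=> xI rx d; pose Q := \prod_(d' | d' != d) ('X - (x d')%:P).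
have sQ : size Q = n.
  rewrite /Q -(big_enum _ _ (predC1 d)) /= size_prod_XsubC -cardE cardC1 card_ord.
  by case: n d {x g xI rx Q} => [[]|].
have : lrational (\sum_(e < n) lpoly Q`_e * \sum_d' lpoly (x d') ^+ e * g d').
  by apply: lrational_sum => e _; apply: lrationalM; [exact: lrational_poly|exact: rx].
rewrite (eq_bigr (fun e : 'I_n =>
    \sum_d' lpoly (Q`_e * x d' ^+ e) * g d')); last first.
  move=> e _; rewrite mulr_sumr; apply: eq_bigr => d' _.
  by rewrite rmorphM rmorphXn mulrA.
rewrite exchange_big /=.
rewrite (eq_bigr (fun d' => lpoly Q.[x d'] * g d')); last first.
  move=> d' _; rewrite -mulr_suml -rmorph_sum; congr (lpoly _ * _).
  by rewrite horner_coef sQ.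
rewrite (bigD1 d)//= big1 ?addr0; last first.
  move=> d' d'd; rewrite (_ : Q.[x d'] = 0) ?rmorph0 ?mul0r//.
  by rewrite /Q (bigD1 d')//= hornerM hornerXsubC subrr mul0r.
apply: lrational_polyMl; rewrite /Q horner_prod; apply/prodf_neq0 => d' d'd.
by rewrite hornerXsubC subr_eq0 (inj_eq xI) eq_sym.
Qed.

(** The coefficient of [1/t]. The values [res (lpoly h * a)] for polynomials [h] determine the
    fractional part of [a], so this pairing provides the characters of the torus. *)
Definition res a : F := a (- 1).

Arguments res a : simpl never.

Lemma resD a b : res (a + b) = res a + res b.
Proof. by []. Qed.

Lemma resB a b : res (a - b) = res a - res b.
Proof. by []. Qed.

Lemma res_sum (I : Type) (r : seq I) (P : pred I) (G : I -> laurent F) :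
  res (\sum_(x <- r | P x) G x) = \sum_(x <- r | P x) res (G x).
Proof. exact: lcoef_sum. Qed.

Lemma res_poly u : res (lpoly u) = 0.
Proof. by []. Qed.

End LaurentPolynomials.

(** * The Cartier operator and residues modulo [z ^ p - z] *)

Section Cartier.
Variables (F : finFieldType) (p : nat).
Hypothesis pcharF : p \in [pchar F].
Implicit Types (a b : laurent F) (u v : {poly F}).

Let p_prime : prime p. Proof. exact: pcharf_prime pcharF. Qed.
Let p_gt0 : (0 < p)%N. Proof. exact: prime_gt0. Qed.

Definition proot : F -> F := invF (fmorph_inj (pFrobenius_aut pcharF)).

Lemma prootK x : proot x ^+ p = x.
Proof. exact: f_invF (fmorph_inj (pFrobenius_aut pcharF)) x. Qed.

Lemma exprp_inj : injective (fun x : F => x ^+ p).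
Proof.
by move=> x y; rewrite -!(pFrobenius_autE pcharF); exact: fmorph_inj.
Qed.

Lemma proot0 : proot 0 = 0.
Proof. by apply: exprp_inj; rewrite /= prootK expr0n gtn_eqF. Qed.

Lemma prootB x y : proot (x - y) = proot x - proot y.
Proof.
apply: exprp_inj; rewrite /= prootK -[RHS](pFrobenius_autE pcharF) rmorphB.
by rewrite /= !pFrobenius_autE !prootK.
Qed.

Lemma prootMp x y : proot (x ^+ p * y) = x * proot y.
Proof. by apply: exprp_inj; rewrite /= prootK exprMn prootK. Qed.

Fact cartier_subproof a : exists n,
  bounded_above (fun i => proot (a (i * p%:Z + p.-1%:Z))) n.
Proof.
have [n an] := lcoef_bounded a; exists `|n|%:Z => i ni.
rewrite an ?proot0//; move: p_gt0; nia.
Qed.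
(** This is the Cartier operator on the differential [a dt]: the index [i * p + p.-1] sends [-1] to
    [-1], so that residues are kept up to a [p]-th root. *)
Definition cartier a := Laurent (cartier_subproof a).

Lemma lcoef_cartier a i : cartier a i = proot (a (i * p%:Z + p.-1%:Z)).
Proof. by []. Qed.

Let cartierB : zmod_morphism cartier.
Proof. by move=> a b; apply: laurentP => i /=; rewrite prootB. Qed.

HB.instance Definition _ :=
  GRing.isZmodMorphism.Build (laurent F) (laurent F) cartier cartierB.

(** Since Frobenius is additive, it is enough to treat constants and ['X]; multiplication by
    ['X ^ p] shifts the index by [p], which becomes a shift by [1] after [cartier]. *)
Lemma cartierMp u a : cartier (lpoly u ^+ p * a) = lpoly u * cartier a.
Proof.
elim/poly_ind: u a => [|u c IH] a.
  by rewrite rmorph0 expr0n gtn_eqF// !mul0r raddf0.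
have pcharP : p \in [pchar {poly F}] by rewrite pchar_lalg.
rewrite -rmorphXn -(pFrobenius_autE pcharP) rmorphD rmorphM /= !pFrobenius_autE.
rewrite !rmorphD !rmorphM/= !mulrDl raddfD /= -mulrA rmorphXn IH -mulrA; congr (_ * _ + _).
  apply: laurentP => i; rewrite lcoef_lpolyXM !lcoef_cartier lcoef_lpolyXnM.
  congr (proot (a _)); lia.
apply: laurentP => i; rewrite lcoef_lpolyCM !lcoef_cartier -rmorphXn lcoef_lpolyCM.
exact: prootMp.
Qed.

Lemma iter_cartierD n a b :
  iter n cartier (a + b) = iter n cartier a + iter n cartier b.
Proof. by elim: n => //= n ->; rewrite raddfD. Qed.

Lemma iter_cartier0 n : iter n cartier 0 = 0.
Proof. by elim: n => //= n ->; rewrite raddf0. Qed.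

Lemma iter_cartierMn n k a : iter n cartier (a *+ k) = iter n cartier a *+ k.
Proof. by elim: n => //= n ->; rewrite raddfMn. Qed.

Lemma iter_cartier_sum n (I : Type) (r : seq I) (P : pred I) G :
  iter n cartier (\sum_(i <- r | P i) G i) =
  \sum_(i <- r | P i) iter n cartier (G i).
Proof.
by elim: n => //= n ->; rewrite raddf_sum.
Qed.

Lemma iter_cartierMX n u a :
  iter n cartier (lpoly u ^+ (p ^ n) * a) = lpoly u * iter n cartier a.
Proof.
elim: n a => [|n IH] a; first by rewrite expn0 expr1.
by rewrite !iterSr -IH expnSr exprM -rmorphXn cartierMp.
Qed.

Lemma res_cartier a : res (cartier a) ^+ p = res a.
Proof. by rewrite /res /= prootK; congr (a _); move: p_gt0; lia. Qed.

Definition artin_schreier : {set F} := [set z ^+ p - z | z in F].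

Lemma artin_schreierB x y : x \in artin_schreier -> y \in artin_schreier ->
  x - y \in artin_schreier.
Proof.
move=> /imsetP[z _ ->] /imsetP[w _ ->]; apply/imsetP; exists (z - w) => //.
by rewrite -!(pFrobenius_autE pcharF) rmorphB /= !opprD !opprK addrACA.
Qed.

Lemma artin_schreier0 : 0 \in artin_schreier.
Proof. by apply/imsetP; exists 0; rewrite ?expr0n ?gtn_eqF ?subrr. Qed.

Lemma artin_schreierN x : x \in artin_schreier -> - x \in artin_schreier.
Proof. by rewrite -sub0r; apply: artin_schreierB; exact: artin_schreier0. Qed.

Lemma artin_schreierD x y : x \in artin_schreier -> y \in artin_schreier ->
  x + y \in artin_schreier.
Proof. by move=> xS /artin_schreierN /(artin_schreierB xS); rewrite opprK. Qed.

Lemma artin_schreier_sum (I : Type) (r : seq I) (P : pred I) (G : I -> F) :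
  (forall i, P i -> G i \in artin_schreier) ->
  \sum_(i <- r | P i) G i \in artin_schreier.
Proof.
by move=> GS; elim/big_ind: _ => //; [exact: artin_schreier0|exact: artin_schreierD].
Qed.

(** By [res_cartier], each application changes the residue by [z ^ p - z], where [z] is the new
    residue. *)
Lemma res_iter_cartier (v : nat) a :
  res a - res (iter v cartier a) \in artin_schreier.
Proof.
elim: v => [|v IH]; first by rewrite subrr artin_schreier0.
rewrite -(subrKA (res (iter v cartier a))); apply: artin_schreierD => //.
by apply/imsetP; exists (res (iter v.+1 cartier a)) => //=; rewrite res_cartier.
Qed.

Definition gamma M j (P : {poly laurent F}) : laurent F :=
  \sum_(v < M) iter v cartier P`_(j * p ^ v).

(** Every [r > 0] is [j * p ^ v] for exactly one pair with [j] prime to [p], namely with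
    [v = logn p r]. *)
Lemma sum_mulpX (V : nmodType) (G : nat -> V) M :
  (forall r, (M <= r)%N -> G r = 0) ->
  \sum_(r < M | (0 < r)%N) G r =
  \sum_(j < M | ~~ (p %| j)%N) \sum_(v < M) G (j * p ^ v)%N.
Proof.
move=> GM.
have p1 := prime_gt1 p_prime.
have Gr (r : 'I_M) : (0 < r)%N -> G r =
    \sum_(jv : 'I_M * 'I_M | ~~ (p %| jv.1)%N && (r == jv.1 * p ^ jv.2 :> nat)%N) G r.
  move=> r0; have [j pj Er] := pfactor_coprime p_prime r0.
  have pv0 : (0 < p ^ logn p r)%N by rewrite expn_gt0 p_gt0.
  have jM : (j < M)%N.
    by apply: leq_ltn_trans (ltn_ord r); rewrite [X in (_ <= X)%N]Er leq_pmulr.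
  have vM : (logn p r < M)%N.
    by apply: leq_ltn_trans (ltn_ord r); apply: ltnW (ltn_logl _ r0).
  rewrite (big_pred1 (Ordinal jM, Ordinal vM))// => -[i v] /=.
  rewrite [in RHS]/eq_op /= -!val_eqE /=; apply/andP/andP => -[].
    move=> pi /eqP Eiv.
    have v_eq : v = logn p r :> nat.
      rewrite Eiv lognM ?expn_gt0 ?p_gt0//.
        by rewrite pfactorK// logn_coprime// prime_coprime.
      by rewrite lt0n; apply: contraNneq pi => ->.
    rewrite -v_eq eqxx; split=> //; apply/eqP/eqP.
    by rewrite -(eqn_pmul2r pv0) -{1}v_eq -Eiv -Er.
  move=> /eqP -> /eqP ->; rewrite -Er eqxx; split=> //.
  by rewrite -prime_coprime.
rewrite pair_big_dep /= (eq_bigr _ Gr).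
rewrite (exchange_big_dep (fun jv : 'I_M * 'I_M => ~~ (p %| jv.1)%N)) /=; last first.
  by move=> r jv _ /andP[].
apply: eq_big => [jv|[j v] /= pj]; first by rewrite ?andbT.
have j0 : (0 < j)%N.
  by rewrite lt0n; apply: contraNneq pj => ->.
have [Mr|rM] := leqP M (j * p ^ v).
  rewrite GM// big1// => r /and3P[_ _ /eqP Er].
  by have := ltn_ord r; rewrite Er ltnNge Mr.
rewrite (big_pred1 (Ordinal rM))// => r; rewrite pj /= -val_eqE /=.
by case: eqP => [->|]; rewrite ?andbF// muln_gt0 j0 expn_gt0 p_gt0.
Qed.

(** In the term of exponent [j * p ^ v], applying [cartier] [v] times costs an element of
    [artin_schreier] and turns [u ^ (j * p ^ v)] into [u ^ j]. The exponent [0] has no such form and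
    stays apart. *)
Lemma res_horner (P : {poly laurent F}) M u : (size P <= M)%N -> (0 < M)%N ->
  res P.[lpoly u] -
   (res P`_0 + \sum_(j < M | ~~ (p %| j)%N) res (gamma M j P * lpoly u ^+ j))
  \in artin_schreier.
Proof.
move=> PM M0.
have nthP r : (M <= r)%N -> P`_r = 0 by move=> Mr; rewrite nth_default ?(leq_trans PM).
rewrite (horner_coef_wide _ PM) [X in res X - _](bigD1 (Ordinal M0))// expr0 mulr1.
rewrite (eq_bigl (fun r : 'I_M => (0 < r)%N)); last by move=> r; rewrite lt0n.
rewrite (@sum_mulpX _ (fun r => P`_r * lpoly u ^+ r)); last first.
  by move=> r /nthP ->; rewrite mul0r.
rewrite resD opprD addrACA subrr add0r res_sum -sumrB.
apply: artin_schreier_sum => j pj.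
rewrite /gamma mulr_suml !res_sum -sumrB; apply: artin_schreier_sum => v _.
rewrite [_ * lpoly u ^+ j]mulrC -[lpoly u ^+ j]rmorphXn -iter_cartierMX.
by rewrite rmorphXn -exprM [_ ^+ _ * _]mulrC; exact: res_iter_cartier.
Qed.

End Cartier.

(** * Averages over the polynomials of degree less than [N] *)

Section Means.
Variables (R : realType) (F : finFieldType).
Implicit Types (f g : {poly F} -> R) (u v h : {poly F}) (N : nat).

Let q_neq0 : #|F|%:R != 0 :> R.
Proof. by rewrite pnatr_eq0 -lt0n ltnW// card_finNzRing_gt1. Qed.

Definition avg N f : R := #|F|%:R ^- N * \sum_(u : {poly_N F}) f u.

Lemma eq_avg N f g : f =1 g -> avg N f = avg N g.
Proof. by move=> fg; congr (_ * _); apply: eq_bigr => u _; exact: fg. Qed.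

Lemma avg_sum N (I : Type) (r : seq I) (P : pred I) (f : I -> {poly F} -> R) :
  avg N (fun u => \sum_(i <- r | P i) f i u) = \sum_(i <- r | P i) avg N (f i).
Proof. by rewrite /avg exchange_big mulr_sumr. Qed.

Lemma avgZ N c f : avg N (fun u => c * f u) = c * avg N f.
Proof. by rewrite /avg -mulr_sumr mulrCA. Qed.

Lemma avgD N f g : avg N (fun u => f u + g u) = avg N f + avg N g.
Proof. by rewrite /avg big_split mulrDr. Qed.

Lemma avg_cst N c : avg N (fun=> c) = c.
Proof.
by rewrite /avg sumr_const card_npoly -[c *+ _]mulr_natr natrX mulrCA mulVf ?mulr1// expf_neq0.
Qed.

Lemma avg_ge0 N f : (forall u, 0 <= f u) -> 0 <= avg N f.
Proof. by move=> f0; rewrite mulr_ge0 ?sumr_ge0// invr_ge0 exprn_ge0. Qed.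

(** The variance is nonnegative. *)
Lemma avg_sqr N f : avg N f ^+ 2 <= avg N (fun u => f u ^+ 2).
Proof.
rewrite -subr_ge0; set m := avg N f.
have -> : avg N (fun u => f u ^+ 2) - m ^+ 2 = avg N (fun u => (f u - m) ^+ 2).
  rewrite (@eq_avg _ (fun u => (f u - m) ^+ 2)
    (fun u => f u ^+ 2 + (- (2 * m) * f u + m ^+ 2))); last first.
    by move=> u; rewrite sqrrB -mulr_natl mulNr mulrAC -mulrA -addrA.
  rewrite !avgD avgZ avg_cst -/m; congr (_ + _).
  by rewrite mulNr -mulrA -expr2 mulr_natl mulr2n opprD subrK.
by apply: avg_ge0 => u; exact: sqr_ge0.
Qed.

Lemma avg_shift N h f : (size h <= N)%N -> avg N (fun u => f (u + h)) = avg N f.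
Proof.
move=> hN; rewrite /avg; congr (_ * _).
have inj : injective (fun u : {poly_N F} => u + npolyp N h) by apply: addIr.
rewrite [RHS](reindex_inj inj)/=; apply: eq_bigr => u _.
by rewrite npolypK.
Qed.

(** Euclidean division by [b]: the map from [(c, w)] to [b * w + c] is injective between sets of
    equal size. *)
Lemma avg_mod N (b : {poly F}) f : b != 0 -> ((size b).-1 <= N)%N ->
  avg N f = #|F|%:R ^- (size b).-1 *
    \sum_(c : {poly_((size b).-1) F}) avg (N - (size b).-1) (fun w => f (b * w + c)).
Proof.
move=> b0; set d := (size b).-1 => dN.
have sb : size b = d.+1 by rewrite prednK// size_poly_gt0.
rewrite -mulr_sumr mulrA -invfM -exprD subnKC// /avg; congr (_ * _).
rewrite pair_big /=.
have sz (cw : {poly_d F} * {poly_(N - d) F}) : (size (b * cw.2 + cw.1)%R <= N)%N.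
  apply: leq_trans (size_polyD _ _) _; rewrite geq_max.
  rewrite (leq_trans (size_npoly cw.1) dN) andbT.
  have [->|w0] := eqVneq (val cw.2) 0; first by rewrite mulr0 size_poly0.
  rewrite size_mul// sb addSn /= -leq_subRL//.
pose h (cw : {poly_d F} * {poly_(N - d) F}) := npolyp N (b * cw.2 + cw.1).
have hI : injective h.
  move=> [c w] [c' w'] /(congr1 val); rewrite /h /= !npolypK ?(sz (_, _))// => E.
  have cb (e : {poly_d F}) : (size e < size b)%N by rewrite sb ltnS size_npoly.
  have Ew : w = w'.
    apply: val_inj; have := congr1 (fun u => u %/ b) E.
    by rewrite /= !divpD ![b * _]mulrC !mulpK// !divp_small// !addr0.
  by congr (_, _) => //; apply: val_inj; move: E; rewrite Ew => /addrI.
have hb : bijective h.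
  apply: inj_card_bij hI _.
  by rewrite card_prod !card_npoly -expnD subnKC.
rewrite (reindex h) /=; last exact: onW_bij.
by apply: eq_bigr => -[c w] _; rewrite /h npolypK ?(sz (_, _)).
Qed.

End Means.

Lemma cvg_sum0 (R : realType) (I : Type) (r : seq I) (P : pred I)
    (f : I -> nat -> R) :
  (forall i, P i -> f i @ \oo --> (0 : R)) ->
  (fun N => \sum_(i <- r | P i) f i N) @ \oo --> (0 : R).
Proof.
move=> f0; elim: r => [|i r IH].
  by rewrite (_ : (fun N => _) = fun=> 0); [exact: cvg_cst|apply/funext => N; rewrite big_nil].
case Pi : (P i); last first.
  rewrite (_ : (fun N => _) = fun N => \sum_(j <- r | P j) f j N)//.
  by apply/funext => N; rewrite big_cons Pi.
rewrite (_ : (fun N => _) = f i \+ fun N => \sum_(j <- r | P j) f j N).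
  by rewrite -[X in _ --> X]addr0; apply: cvgD; [exact: f0 | exact: IH].
by apply/funext => N; rewrite big_cons Pi.
Qed.

(** * Equidistribution modulo [artin_schreier] and van der Corput's inequality *)

Section Discrepancy.
Variables (R : realType) (F : finFieldType) (p : nat).
Hypothesis pcharF : p \in [pchar F].
Implicit Types (x y : F) (g : {poly F} -> F) (u v h : {poly F}).

Local Notation AS := (artin_schreier F p).

Let q_gt0 : 0 < #|F|%:R :> R.
Proof. by rewrite ltr0n ltnW// card_finNzRing_gt1. Qed.

(* This function replaces the additive characters of [F]: it is the sum of the
   nontrivial ones that are trivial on [AS], up to a constant factor. *)
Definition disc x : R := (x \in AS)%:R - #|AS|%:R / #|F|%:R.

Lemma disc_congr x y : x - y \in AS -> disc x = disc y.
Proof.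
move=> xy; congr (_%:R - _); congr nat_of_bool; apply/idP/idP => [xS|yS].
  by rewrite -[y](subKr x); exact: (artin_schreierB pcharF).
by rewrite -[x](subrK y); exact: (artin_schreierD pcharF).
Qed.

Lemma sum_indicator_AS x : \sum_y (x + y \in AS)%:R = #|AS|%:R :> R.
Proof.
transitivity (\sum_(y : F) (y \in AS)%:R : R).
  by rewrite [RHS](reindex_inj (addrI x)).
by rewrite -natr_sum; congr _%:R; rewrite -sum1_card [RHS]big_mkcond.
Qed.

Lemma sum_disc x : \sum_y disc (x + y) = 0.
Proof.
rewrite sumrB sum_indicator_AS sumr_const -[(_ / _) *+ _]mulr_natr divfK ?subrr//.
by rewrite gt_eqF.
Qed.

(** The substitute for multiplying a character by a conjugate one. The constant part of the second
    factor contributes zero by [sum_disc], and wherever [y + z] lies in [AS], the first factor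
    equals [disc (x - y)]. *)
Lemma disc_corr x y :
  \sum_z disc (x + z) * disc (y + z) = #|AS|%:R * disc (x - y).
Proof.
have -> : \sum_z disc (x + z) * disc (y + z) =
    \sum_z disc (x + z) * (y + z \in AS)%:R.
  rewrite (eq_bigr (fun z => disc (x + z) * (y + z \in AS)%:R -
    #|AS|%:R / #|F|%:R * disc (x + z))); last first.
    by move=> z _; rewrite /disc mulrBr [_ / _ * _]mulrC.
  by rewrite sumrB -mulr_sumr sum_disc mulr0 subr0.
rewrite (eq_bigr (fun z => disc (x - y) * (y + z \in AS)%:R)).
  by rewrite -mulr_sumr sum_indicator_AS mulrC.
move=> z _.
case yz : (y + z \in AS); rewrite ?mulr0//; congr (_ * _).
by apply: disc_congr; rewrite (_ : x + z - (x - y) = y + z)//; ring.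
Qed.

(** [AS] is a proper subset of [F], since [z ^ p - z] takes the same value at [0] and [1]. *)
Lemma disc0_gt0 : 0 < disc 0.
Proof.
rewrite /disc artin_schreier0// subr_gt0 ltr_pdivrMr// mul1r ltr_nat.
rewrite ltn_neqAle max_card andbT; apply/negP => /eqP card_AS.
have inj : {in F &, injective (fun z : F => z ^+ p - z)}.
  by apply/imset_injP; rewrite -/AS card_AS.
have := inj 0 1 isT isT.
rewrite expr1n expr0n gtn_eqF ?prime_gt0 ?(pcharf_prime pcharF)// !subrr.
by move=> /(_ erefl)/eqP; rewrite eq_sym oner_eq0.
Qed.

(** Letting [y] vary separates the characters summed up in [disc]: the condition says that each of
    them has mean tending to zero along [g]. *)
Definition disc_equidistributed g :=
  forall y, (fun N => avg N (fun u => disc (g u + y))) @ \oo --> (0 : R).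

Lemma disc_equidistributed_congr g g' :
  (forall u, g u - g' u \in AS) ->
  disc_equidistributed g' -> disc_equidistributed g.
Proof.
move=> gg' ug y; rewrite (_ : (fun N => _) = fun N => avg N (fun u => disc (g' u + y))) //.
apply/funext => N; apply: eq_avg => u; apply: disc_congr.
by rewrite opprD addrACA subrr addr0.
Qed.

Lemma disc_equidistributed_shift g h :
  disc_equidistributed g -> disc_equidistributed (fun u => g (u + h)).
Proof.
move=> ug y; apply: cvg_trans (ug y); apply: near_eq_cvg.
near=> N; rewrite (@avg_shift _ _ N h (fun u => disc (g u + y)))//.
by near: N; exact: nbhs_infty_ge.
Unshelve. all: by end_near. Qed.

Lemma disc_equidistributed_mod g (b : {poly F}) : b != 0 ->
  (forall c, disc_equidistributed (fun w => g (b * w + c))) ->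
  disc_equidistributed g.
Proof.
move=> b0 ug y; set d := (size b).-1.
pose T N := #|F|%:R ^- d *
  \sum_(c : {poly_d F}) avg (N - d) (fun w => disc (g (b * w + c) + y)) : R.
have : T @ \oo --> (0 : R).
  rewrite -(mulr0 (#|F|%:R ^- d)); apply: cvgMr.
  apply: cvg_sum0 => c _.
  rewrite -(cvg_shiftn d); apply: cvg_trans (ug c y); apply: near_eq_cvg.
  by apply: nearW => N /=; rewrite addnK.
apply: cvg_trans; apply: near_eq_cvg; near=> N.
symmetry; apply: (avg_mod (fun u => disc (g u + y)) b0).
by near: N; exact: nbhs_infty_ge.
Unshelve. all: by end_near. Qed.

(** An irrational [b] is not a polynomial, so it has a nonzero coefficient at some negative
    exponent. Translating [u] by multiples of a monomial then shifts the residue by any [c], and the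
    sum over [c] vanishes. *)
Lemma disc_equidistributed_linear (b : laurent F) : lirrational b ->
  disc_equidistributed (fun u => res (b * lpoly u)).
Proof.
move=> irr y.
have [n bn] : exists n : nat, b (Negz n) != 0.
  apply: contrapT => nex; apply: irr.
  have [m bm] := lcoef_bounded b.
  exists (\poly_(i < `|m|.+1) b i%:Z), 1; rewrite oner_neq0 rmorph1 divr1; split=> //.
  apply: laurentP => -[i|i] /=.
    by rewrite coef_poly; case: ltnP => // im; rewrite bm//; lia.
  by apply/eqP; rewrite -[_ == _]negbK; apply/negP => bi; apply: nex; exists i.
pose h (c : F) := (c / b (Negz n)) *: 'X^n.
have res_h u c : res (b * lpoly (u + h c)) = res (b * lpoly u) + c.
  rewrite rmorphD mulrDr resD; congr (_ + _).
  rewrite mulrC /h -mul_polyC rmorphM -mulrA /res lcoef_lpolyCM lcoef_lpolyXnM.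
  by rewrite (_ : -1 - n%:Z = Negz n) ?divfK//; lia.
(* Once the averaging domain contains every [h c], the averages are exactly zero. *)
rewrite -(cvg_shiftn n.+1).
rewrite (_ : (fun N => _) = fun=> (0 : R)); first exact: cvg_cst.
apply/funext => N; set f := fun u => disc _; set A := avg _ f.
have Ac c : A = avg (N + n.+1) (fun u => disc (res (b * lpoly u) + y + c)).
  rewrite /A -(avg_shift (h := h c)); last first.
    by rewrite (leq_trans (size_scale_leq _ _))// size_polyXn leq_addl.
  by apply: eq_avg => u; rewrite /f res_h addrAC.
have : \sum_(c : F) A = 0.
  rewrite (eq_bigr _ (fun c _ => Ac c)) -avg_sum.
  by rewrite (@eq_avg _ _ _ _ (fun=> 0)) ?avg_cst// => u; exact: sum_disc.
rewrite sumr_const => /eqP; rewrite mulrn_eq0 => /orP[|/eqP//].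
by rewrite -(pnatr_eq0 R) gt_eqF.
Qed.

(** The average is replaced by its mean over [n] shifts and squared. The diagonal pairs contribute
    [O(1 / n)], and the other pairs tend to zero by hypothesis. *)
Lemma van_der_corput g :
  (forall n : nat, exists h : 'I_n -> {poly F}, forall i j, i != j ->
     disc_equidistributed (fun u => g (u + h i) - g (u + h j))) ->
  disc_equidistributed g.
Proof.
move=> gh y; apply/cvgrPdist_lt => e e0.
pose A : R := #|AS|%:R.
have A_ge0 : 0 <= A by [].
(* The number of shifts is chosen so that the diagonal contributes less than half of [e ^+ 2]. *)
have [H HA] : exists H : nat, A * disc 0 / H.+1%:R < e ^+ 2 / 2.
  exists (Num.truncn (A * disc 0 / (e ^+ 2 / 2))).
  rewrite ltr_pdivrMr// -ltr_pdivrMl ?divr_gt0 ?exprn_gt0// [ltLHS]mulrC.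
  exact: truncnS_gt.
have [h hd] := gh H.+1; pose n : R := H.+1%:R.
have n0 : 0 < n by rewrite ltr0n.
pose T N := A / n ^+ 2 * \sum_i \sum_(j | i != j)
  avg N (fun u => disc (g (u + h i) - g (u + h j))).
have T0 : T @ \oo --> (0 : R).
  rewrite -[X in _ --> X](mulr0 (A / n ^+ 2)); apply: cvgMr.
  apply: cvg_sum0 => i _; apply: cvg_sum0 => j ij.
  have := hd _ _ ij 0; apply: cvg_trans; apply: near_eq_cvg.
  by apply: nearW => N; apply: eq_avg => u; rewrite addr0.
have e2 : 0 < e ^+ 2 / 2 by rewrite divr_gt0 ?exprn_gt0.
have /cvgrPdist_lt /(_ _ e2) := T0; apply: filter_app.
near=> N => TN; rewrite sub0r normrN in TN; rewrite sub0r normrN.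
have hN i : (size (h i) <= N)%N.
  apply: leq_trans (leq_bigmax i) (_ : \max_j size (h j) <= N)%N.
  by near: N; exact: nbhs_infty_ge.
have bound : avg N (fun u => disc (g u + y)) ^+ 2 <=
    A * disc 0 / n + T N.
  pose f z u := disc (g u + z).
  (* The single [y] is enlarged to all [z] in [F], so that [disc_corr] can evaluate the products. *)
  apply: (@le_trans _ _ (\sum_z avg N (f z) ^+ 2)).
    by rewrite (bigD1 y)//= lerDl sumr_ge0// => z _; exact: sqr_ge0.
  have Ef z : avg N (f z) = avg N (fun u => n^-1 * \sum_i f z (u + h i)).
    rewrite avgZ avg_sum (eq_bigr (fun=> avg N (f z))).
      by rewrite sumr_const card_ord -[_ *+ _]mulr_natr mulrCA mulVf ?mulr1// gt_eqF.
    by move=> i _; exact: (@avg_shift _ _ N (h i) (f z)).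
  apply: (@le_trans _ _ (\sum_z avg N (fun u => (n^-1 * \sum_i f z (u + h i)) ^+ 2))).
    by apply: ler_sum => z _; rewrite Ef; exact: avg_sqr.
  rewrite -avg_sum.
  have Ec u : \sum_z (n^-1 * \sum_i f z (u + h i)) ^+ 2 =
     A / n ^+ 2 * \sum_i \sum_j disc (g (u + h i) - g (u + h j)).
    rewrite (eq_bigr (fun z => n ^- 2 * \sum_i \sum_j f z (u + h i) * f z (u + h j))).
      rewrite -mulr_sumr [A / _]mulrC -mulrA; congr (_ * _).
      rewrite exchange_big mulr_sumr; apply: eq_bigr => i _.
      rewrite exchange_big mulr_sumr; apply: eq_bigr => j _.
      exact: disc_corr.
    move=> z _; rewrite exprMn exprVn; congr (_ * _).
    by rewrite expr2 mulr_suml; apply: eq_bigr => i _; rewrite mulr_sumr.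
  rewrite (eq_avg _ Ec) avgZ avg_sum.
  rewrite (eq_bigr (fun i => disc 0 +
    \sum_(j | i != j) avg N (fun u => disc (g (u + h i) - g (u + h j))))).
    rewrite big_split mulrDr /= -/(T N) lerD2r sumr_const card_ord -mulr_natr.
    by rewrite -/n le_eqVlt; apply/orP; left; apply/eqP; field; rewrite gt_eqF.
  move=> i _; rewrite avg_sum (bigD1 i)//=; congr (_ + _).
    by rewrite (@eq_avg _ _ _ _ (fun=> disc 0)) ?avg_cst// => u; rewrite subrr.
  by apply: eq_bigl => j; rewrite eq_sym.
rewrite -(@ltr_pXn2r _ 2)// ?nnegrE ?ltW// -normrX ger0_norm ?sqr_ge0//.
apply: le_lt_trans bound _; rewrite [ltRHS](splitr (e ^+ 2)).
by apply: ltrD => //; apply: le_lt_trans TN; exact: ler_norm.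
Unshelve. all: by end_near. Qed.

End Discrepancy.

(** * Coefficients of linear substitutions, and binomials modulo [p] *)

Section Binomials.

Lemma coef_linearX (A : comNzRingType) (a c : A) r j :
  ((a *: 'X + c%:P) ^+ r)`_j = a ^+ j * c ^+ (r - j) *+ 'C(r, j).
Proof.
rewrite addrC exprDn coef_sum.
have Ei (i : 'I_r.+1) : (c%:P ^+ (r - i) * (a *: 'X) ^+ i *+ 'C(r, i))`_j =
    (if i == j :> nat then a ^+ j * c ^+ (r - j) *+ 'C(r, j) else 0).
  rewrite coefMn -polyC_exp coefCM exprZn coefZ coefXn eq_sym.
  by case: eqP => [->|_]; rewrite ?mulr1 ?mulr0 ?mul0rn 1?mulrC.
rewrite (eq_bigr _ (fun i _ => Ei i)) -big_mkcond.
have [jr|rj] := leqP j r.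
  by rewrite (big_pred1 (Ordinal (jr : (j < r.+1)%N))).
by rewrite bin_small// mulr0n big1.
Qed.

Lemma coef_comp_linear (A : comNzRingType) (P : {poly A}) M (a c : A) j :
  (size P <= M)%N ->
  (P \Po (a *: 'X + c%:P))`_j =
  \sum_(r < M) P`_r * (a ^+ j * c ^+ (r - j)) *+ 'C(r, j).
Proof.
move=> PM; rewrite coef_comp_poly.
rewrite (big_ord_widen _ (fun r => P`_r * ((a *: 'X + c%:P) ^+ r)`_j) PM) big_mkcond.
apply: eq_bigr => r _; rewrite coef_linearX mulrnAr.
by case: ltnP => // Pr; rewrite nth_default ?mul0r ?mul0rn.
Qed.

(** Coefficients are compared in [(X + 1) ^ (a * p) = (X ^ p + 1) ^ a]. *)
Lemma bin_mulp (A : comNzRingType) p a b : p \in [pchar A] ->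
  'C(a * p, b * p)%:R = 'C(a, b)%:R :> A.
Proof.
move=> pcharA; have p0 := prime_gt0 (pcharf_prime pcharA).
have pcharP : p \in [pchar {poly A}] by rewrite pchar_poly.
have E n : (('X + 1) ^+ n : {poly A}) = (1 *: 'X + 1%:P) ^+ n by rewrite scale1r.
have : (('X + 1) ^+ (a * p) : {poly A}) = (('X + 1) ^+ a) \Po 'X^p.
  rewrite rmorphXn rmorphD rmorph1 /= comp_polyX mulnC exprM.
  by rewrite -(pFrobenius_autE pcharP) rmorphD rmorph1 /= pFrobenius_autE.
move=> /(congr1 (fun P : {poly A} => P`_(b * p))).
rewrite coef_comp_poly_Xn// dvdn_mull// mulnK// !E !coef_linearX.
by rewrite !expr1n !mulr1.
Qed.

Lemma bin_mulpX (A : comNzRingType) p a b v : p \in [pchar A] ->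
  'C(a * p ^ v, b * p ^ v)%:R = 'C(a, b)%:R :> A.
Proof.
move=> pcharA; elim: v => [|v IH]; first by rewrite !muln1.
by rewrite expnSr !mulnA bin_mulp.
Qed.

End Binomials.

(** * Irrational values of [p]-semilinear forms *)

Section SemilinearForms.
Variables (F : finFieldType) (p : nat).
Hypothesis pcharF : p \in [pchar F].
Implicit Types (h : {poly F}) (c : nat -> nat -> laurent F).

Let p_prime : prime p. Proof. exact: pcharf_prime pcharF. Qed.
Let p_gt1 : (1 < p)%N. Proof. exact: prime_gt1. Qed.
Let p_gt0 : (0 < p)%N. Proof. exact: prime_gt0. Qed.

Local Notation cartier := (cartier pcharF).

(** The range [M + M] leaves room for the index [v + i0] with [v] and [i0] below [M]. *)
Definition cform M c h : laurent F :=
  \sum_(v < M) \sum_(i < M + M) iter v cartier (c v i * lpoly h ^+ (p ^ i)).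

Lemma cformB M c h h' : cform M c (h - h') = cform M c h - cform M c h'.
Proof.
rewrite /cform -sumrB; apply: eq_bigr => v _; rewrite -sumrB.
apply: eq_bigr => i _.
have pcharP : p \in [pchar {poly F}] by rewrite pchar_poly.
have -> : lpoly (h - h') ^+ (p ^ i) = lpoly h ^+ (p ^ i) - lpoly h' ^+ (p ^ i).
  rewrite -!rmorphXn -rmorphB; congr lpoly.
  elim: (i : nat) => [|n IH]; first by rewrite !expr1.
  by rewrite expnSr !exprM IH -!(pFrobenius_autE pcharP) rmorphB.
have iterB a b : iter v cartier (a - b) = iter v cartier a - iter v cartier b.
  by rewrite -[in RHS](subrK b a) [in RHS]iter_cartierD addrK.
by rewrite mulrBr iterB.
Qed.

(* Multiplying [h] by powers of ['X] separates the terms of [cform] according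
   to the value of [i - v]. *)
Lemma lirrational_cform M c i0 h : (i0 < M)%N -> h != 0 ->
  lirrational (\sum_(v < M) iter v cartier (c v (v + i0)%N)) ->
  exists2 e, (e < M + (M + M))%N & lirrational (cform M c (h * 'X^(p ^ M * e))).
Proof.
move=> i0M h0 irr; apply: contrapT => nex.
have rat e : (e < M + (M + M))%N -> lrational (cform M c (h * 'X^(p ^ M * e))).
  by move=> eM; apply: contrapT => ir; apply: nex; exists e.
pose x (d : 'I_(M + (M + M))) : {poly F} := 'X^(p ^ d).
have xI : injective x.
  move=> d d' /(congr1 (fun P : {poly F} => size P)); rewrite !size_polyXn => -[].
  by move=> /(expnI p_gt1) /val_inj.
pose T (v i : nat) := iter v cartier (c v i * lpoly h ^+ (p ^ i)).
(* [g d] collects the terms with [i - v = d - M]; the offset [M] keeps [d] a natural number. *)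
pose g (d : 'I_(M + (M + M))) := \sum_(v < M) \sum_(i < M + M | (M + i == d + v)%N) T v i.
have gE e : (e < M + (M + M))%N -> lrational (\sum_d lpoly (x d) ^+ e * g d).
  move=> /rat; rewrite /cform; congr lrational; symmetry.
  rewrite (eq_bigr (fun d : 'I_(M + (M + M)) => \sum_(v < M) \sum_(i < M + M)
     if (M + i == d + v)%N then lpoly (x d) ^+ e * T v i else 0)); last first.
    move=> d _; rewrite mulr_sumr; apply: eq_bigr => v _.
    by rewrite mulr_sumr big_mkcond.
  rewrite exchange_big; apply: eq_bigr => v _ /=.
  rewrite exchange_big; apply: eq_bigr => i _ /=.
  rewrite -big_mkcond.
  have vM := ltn_ord v; have iM := ltn_ord i.
  have dM : (M + i - v < M + (M + M))%N by lia.
  rewrite (big_pred1 (Ordinal dM)); last first.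
    by move=> d /=; apply/eqP/eqP => [E|-> /=]; [apply: val_inj => /=|]; lia.
  rewrite /T rmorphM exprMn mulrA.
  (* The factor [p ^ M] makes this a [p ^ v]-th power for every [v < M], so that it passes through
     [v] applications of [cartier] and becomes [x d ^+ e]. *)
  have -> : lpoly 'X^(p ^ M * e) ^+ (p ^ i) =
      lpoly ('X^(p ^ (M + i - v) * e) : {poly F}) ^+ (p ^ v).
    rewrite -!rmorphXn -!exprM; congr (lpoly 'X^_).
    rewrite ![(_ * e)%N]mulnC -!mulnA -!expnD; congr (_ * _ ^ _)%N; lia.
  rewrite [_ * lpoly _ ^+ (p ^ v)]mulrC iter_cartierMX; congr (_ * _).
  by rewrite /x -rmorphXn -exprM.
have := lrational_vandermonde xI gE.
have dM : (M + i0 < M + (M + M))%N by lia.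
move=> /(_ (Ordinal dM)); rewrite /g /=.
have -> : \sum_(v < M) \sum_(i < M + M | (M + i == M + i0 + v)%N) T v i =
    lpoly (h ^+ (p ^ i0)) * \sum_(v < M) iter v cartier (c v (v + i0)%N).
  rewrite mulr_sumr; apply: eq_bigr => v _.
  have iM : (v + i0 < M + M)%N by have := ltn_ord v; lia.
  rewrite (big_pred1 (Ordinal iM)); last first.
    by move=> i /=; apply/eqP/eqP => [E|-> /=]; [apply: val_inj => /=|]; lia.
  rewrite /T /= mulrC addnC expnD exprM -rmorphXn iter_cartierMX//.
move=> /lrational_polyMl; rewrite expf_neq0// => /(_ isT); exact: irr.
Qed.

(** The polynomials with rational [cform] form an additive group; the statement is that its index is
    infinite. *)
Lemma cform_infinite_index M c i0 : (i0 < M)%N ->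
  lirrational (\sum_(v < M) iter v cartier (c v (v + i0)%N)) ->
  forall n, exists h : 'I_n -> {poly F},
    forall i j, i != j -> lirrational (cform M c (h i - h j)).
Proof.
move=> i0M irr; elim=> [|n [h hI]]; first by exists (fun=> 0) => -[].
apply: contrapT => nex.
(* If the family cannot be extended, the cosets of the [h i] cover all polynomials. *)
have cl (u : {poly F}) : exists i, lrational (cform M c (u - h i)).
  apply: contrapT => nu; apply: nex.
  exists (fun i => if unlift ord_max i is Some j then h j else u) => i j.
  have Nu k : lirrational (cform M c (u - h k)) by move=> rk; apply: nu; exists k.
  case: unliftP => [i'|] ->; case: unliftP => [j'|] ->.
  - by rewrite (inj_eq lift_inj); exact: hI.
  - by rewrite cformB -opprB -cformB => _ /lrationalN; rewrite opprK; exact: Nu.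
  - by move=> _; exact: Nu.
  - by rewrite eqxx.
have [f fP] := choice cl; pose D := (M + (M + M))%N.
(* By pigeonhole two exponents [k] and [k'] give the same cosets for all [e < D] at once;
   ['X^k - 'X^k'] then contradicts [lirrational_cform]. *)
pose G (k : 'I_(#|{ffun 'I_D -> 'I_n}|.+1)) : {ffun 'I_D -> 'I_n} :=
  [ffun e : 'I_D => f ('X^k * 'X^(p ^ M * e))].
have /injectivePn [k [k' kk' Gkk']] : ~~ injectiveb G.
  by apply/injectiveP => /leq_card; rewrite card_ord ltnn.
have h0 : 'X^k - 'X^k' != 0 :> {poly F}.
  rewrite subr_eq0; apply: contra kk' => /eqP/(congr1 (fun P : {poly F} => size P)).
  by rewrite !size_polyXn => -[] /val_inj ->.
have [e eD] := lirrational_cform i0M h0 irr; apply.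
have := congr1 (fun H : {ffun _ -> _} => H (Ordinal eD)) Gkk'; rewrite !ffunE /= => ff.
have := lrationalB (fP ('X^k * 'X^(p ^ M * e))) (fP ('X^k' * 'X^(p ^ M * e))).
by rewrite ff -cformB opprB addrA subrK mulrBl.
Qed.

End SemilinearForms.

(** * Weyl differencing and the induction on the digit sum *)

Section Weyl.
Variables (R : realType) (F : finFieldType) (p : nat).
Hypothesis pcharF : p \in [pchar F].
Implicit Types (P : {poly laurent F}) (u h : {poly F}).

Let p_prime : prime p. Proof. exact: pcharf_prime pcharF. Qed.
Let p_gt1 : (1 < p)%N. Proof. exact: prime_gt1. Qed.
Let p_gt0 : (0 < p)%N. Proof. exact: prime_gt0. Qed.

Local Notation cartier := (cartier pcharF).
Local Notation gamma := (gamma pcharF).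
Local Notation ds := (digit_sum p).
Local Notation equid := (disc_equidistributed R p).

Lemma pchar_laurent : p \in [pchar laurent F].
Proof.
by apply: (rmorph_pchar (@lpoly F)); rewrite pchar_poly.
Qed.

Lemma mulrn_bin_neq0 (a : laurent F) r j : a *+ 'C(r, j) != 0 ->
  (j <= r)%N /\ ds r = (ds j + ds (r - j))%N.
Proof.
move=> aC; have jr : (j <= r)%N.
  by rewrite leqNgt; apply: contra aC => rj; rewrite bin_small.
split=> //; apply/(ndvdn_bin p_prime jr); apply: contra aC.
by rewrite (dvdn_pcharf pchar_laurent) => /eqP C0; rewrite -mulr_natr C0 mulr0.
Qed.

(** The factor [1 *:] matches the shape required by [coef_comp_linear]. *)
Definition pdiff h P := P \Po (1 *: 'X + (lpoly h)%:P) - P.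

Lemma horner_pdiff h P u :
  (pdiff h P).[lpoly u] = P.[lpoly (u + h)] - P.[lpoly u].
Proof. by rewrite /pdiff !hornerE horner_comp !hornerE rmorphD. Qed.

Lemma size_comp_linear P M (a c : laurent F) : (size P <= M)%N ->
  (size (P \Po (a *: 'X + c%:P)) <= M)%N.
Proof.
move=> PM; apply/leq_sizeP => j Mj; rewrite (coef_comp_linear _ _ _ PM).
by rewrite big1// => r _; rewrite bin_small// (leq_trans (ltn_ord r)).
Qed.

Lemma size_pdiff h P M : (size P <= M)%N -> (size (pdiff h P) <= M)%N.
Proof.
move=> PM; apply: leq_trans (size_polyD _ _) _.
by rewrite geq_max size_polyN PM size_comp_linear.
Qed.

(** A nonzero binomial forces [ds r = ds m + ds (r - m)], so [ds (r - m)] is at most [1]: the term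
    [r = m] cancels against [P], and otherwise [r - m] is a power of [p]. *)
Lemma coef_pdiff h P M s m : (size P <= M)%N ->
  (forall r, (s.+1 < ds r)%N -> P`_r = 0) -> ds m = s ->
  (pdiff h P)`_m = \sum_(i < M + M)
    P`_(m + p ^ i) *+ 'C(m + p ^ i, m) * lpoly h ^+ (p ^ i).
Proof.
move=> PM Ps dm; pose T r := P`_r * (1 ^+ m * lpoly h ^+ (r - m)) *+ 'C(r, m).
have T0 r : (M <= r)%N -> T r = 0.
  by move=> Mr; rewrite /T nth_default ?(leq_trans PM)// mul0r mul0rn.
have Tm : T m = P`_m by rewrite /T subnn binn expr1n !mulr1.
rewrite coefB (coef_comp_linear _ _ _ PM) -/T.
(* For [M <= m] the sum has no term [r = m], but then the coefficient of [P] at [m] is zero. *)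
have -> : \sum_(r < M) T r = \sum_(r < M | r != m :> nat) T r + P`_m.
  have [mM|Mm] := ltnP m M.
    by rewrite (bigD1 (Ordinal mM))//= Tm addrC.
  rewrite [P`_m]nth_default ?(leq_trans PM)// addr0; apply: eq_bigl => r.
  by apply/esym; rewrite ltn_eqF ?(leq_trans (ltn_ord r)).
rewrite addrK.
have Tr (r : 'I_M) : (r != m :> nat) ->
    T r = \sum_(i < M + M | (m + p ^ i == r)%N) T r.
  move=> rm; have [->|Tr0] := eqVneq (T r) 0; first by rewrite big1.
  have [mr dr] := mulrn_bin_neq0 Tr0.
  have d1 : ds (r - m) = 1%N.
    have : (ds r <= s.+1)%N.
      rewrite leqNgt; apply: contra Tr0 => /Ps; rewrite /T => ->.
      by rewrite mul0r mul0rn.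
    have : ds (r - m) != 0%N.
      by rewrite digit_sum_eq0// subn_eq0 -ltnNge ltn_neqAle mr eq_sym rm.
    by rewrite dr dm; lia.
  have [i Ei] := digit_sum_eq1 p_prime d1.
  have Er : (m + p ^ i = r)%N by rewrite -Ei subnKC.
  have iM : (i < M + M)%N.
    apply: leq_trans (ltn_expl i p_gt1) _; rewrite -Ei.
    apply: leq_trans (leq_subr _ _) _; exact: leq_trans (ltnW (ltn_ord r)) (leq_addr _ _).
  rewrite (big_pred1 (Ordinal iM))// => i' /=; rewrite -Er eqn_add2l.
  by rewrite eqn_exp2l.
rewrite (eq_bigr _ Tr) (exchange_big_dep predT)//=; apply: eq_bigr => i _.
have pi0 : (0 < p ^ i)%N by rewrite expn_gt0 p_gt0.
transitivity (T (m + p ^ i)%N); last first.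
  by rewrite /T expr1n mul1r addKn mulrnAl.
have [Mr|rM] := leqP M (m + p ^ i).
  rewrite T0// big1// => r /andP[_ /eqP Er].
  by have := ltn_ord r; rewrite -Er ltnNge Mr.
rewrite (big_pred1 (Ordinal rM))// => r /=; apply/andP/eqP => [[_ /eqP E]|->/=].
  exact: val_inj.
by rewrite eqxx -[X in _ != X]addn0 eqn_add2l -lt0n.
Qed.

Lemma gamma_pdiff h P M s j : (size P <= M)%N ->
  (forall r, (s.+1 < ds r)%N -> P`_r = 0) -> ds j = s ->
  gamma M j (pdiff h P) = cform pcharF M
    (fun v i => P`_(j * p ^ v + p ^ i) *+ 'C(j * p ^ v + p ^ i, j * p ^ v)) h.
Proof.
move=> PM Ps dj; apply: eq_bigr => v _; rewrite -iter_cartier_sum.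
by rewrite (coef_pdiff _ PM Ps)// digit_sumMX.
Qed.

Lemma pdiff_support h P s : (forall r, (s.+1 < ds r)%N -> P`_r = 0) ->
  forall r, (s < ds r)%N -> (pdiff h P)`_r = 0.
Proof.
move=> Ps m sm; rewrite coefB (coef_comp_linear _ _ _ (leqnn _)).
have [mP|Pm] := ltnP m (size P); last first.
  rewrite [P`_m]nth_default// subr0 big1// => r _.
  by rewrite bin_small// (leq_trans (ltn_ord r)).
rewrite (bigD1 (Ordinal mP))//= subnn binn expr1n !mulr1 big1 ?addr0 ?subrr//.
move=> r rm; apply/eqP/negPn/negP => Tr0.
have [mr dr] := mulrn_bin_neq0 Tr0.
have : ds (r - m) != 0%N.
  by rewrite digit_sum_eq0// subn_eq0 -ltnNge ltn_neqAle mr eq_sym andbT.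
have : (ds r <= s.+1)%N.
  by rewrite leqNgt; apply: contra Tr0 => /Ps ->; rewrite mul0r mul0rn.
rewrite dr -lt0n => le_s dr0.
by have := leq_trans (leq_add sm dr0) le_s; rewrite addn1 ltnn.
Qed.

Lemma disc_equidistributed_congr_cst g g' (c : F) :
  (forall u, g u - (c + g' u) \in artin_schreier F p) -> equid g' -> equid g.
Proof.
move=> gg' ug; apply: (disc_equidistributed_congr pcharF gg') => y.
apply: cvg_trans (ug (c + y)); apply: near_eq_cvg; apply: nearW => N.
by apply: eq_avg => u; congr (disc _ _ _); ring.
Qed.

(** Only the exponent [0] and powers of [p] occur, and all powers of [p] merge into the linear term
    with coefficient [gamma M 1 P]. *)
Lemma disc_equidistributed_degree1 P M : (size P <= M)%N -> (1 < M)%N ->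
  (forall r, (1 < ds r)%N -> P`_r = 0) -> lirrational (gamma M 1 P) ->
  equid (fun u => res P.[lpoly u]).
Proof.
move=> PM M1 Ps irr.
apply: (@disc_equidistributed_congr_cst _ (fun u => res (gamma M 1 P * lpoly u)) (res P`_0)); last first.
  exact: disc_equidistributed_linear.
move=> u; have := res_horner pcharF u PM (ltnW M1).
have p1 : ~~ (p %| Ordinal M1)%N by rewrite dvdn1 gtn_eqF.
rewrite (bigD1 (Ordinal M1))// expr1 [X in _ + (_ + X)]big1 ?addr0//.
move=> j /andP[pj j1].
have j0 : (0 < j)%N by rewrite lt0n; apply: contraNneq pj => ->.
have dj : (1 < ds j)%N.
  rewrite ltn_neqAle lt0n digit_sum_eq0// -lt0n j0 andbT eq_sym; apply/eqP.
  move=> /(digit_sum_eq1 p_prime) [[|i] Ei].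
    by case/eqP: j1; apply: val_inj.
  by move: pj; rewrite Ei dvdn_exp.
rewrite /gamma big1 ?mul0r// => v _; rewrite Ps ?iter_cartier0//.
by rewrite digit_sumMX.
Qed.

(** Induction on the top digit sum: van der Corput's inequality replaces [P] by
    [pdiff (h i - h i') P] and [k] by [j = k - p ^ i0]. *)
Lemma disc_equidistributed_top_digit_sum s P M k : (size P <= M)%N -> (k < M)%N ->
  ~~ (p %| k)%N -> ds k = s.+1 -> (forall r, (s.+1 < ds r)%N -> P`_r = 0) ->
  lirrational (gamma M k P) -> equid (fun u => res P.[lpoly u]).
Proof.
elim: s P k => [|s IH] P k PM kM pk dk Ps irr.
  have [[|i] Ek] := digit_sum_eq1 p_prime dk; last by rewrite Ek dvdn_exp in pk.
  by move: kM irr; rewrite Ek => kM irr; exact: (disc_equidistributed_degree1 PM kM).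
have [] := digit_sum_subX_coprime p_prime pk; first by rewrite dk.
move=> i0 [i0k pj]; rewrite dk => -[dj]; set j := (k - p ^ i0)%N in pj dj.
have Ek : (j + p ^ i0 = k)%N by rewrite subnK.
have i0M : (i0 < M)%N.
  exact: leq_ltn_trans (leq_trans (ltnW (ltn_expl i0 p_gt1)) i0k) kM.
have jM : (j < M)%N by apply: leq_ltn_trans kM; exact: leq_subr.
pose c v i : laurent F :=
  P`_(j * p ^ v + p ^ i) *+ 'C(j * p ^ v + p ^ i, j * p ^ v).
(* As [j * p ^ v + p ^ (v + i0) = k * p ^ v], this sum is [gamma M k P] times ['C(k, j)], which is
   nonzero modulo [p] by Kummer's theorem. *)
have irrc : lirrational (\sum_(v < M) iter v cartier (c v (v + i0)%N)).
  have -> : \sum_(v < M) iter v cartier (c v (v + i0)%N) =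
      lpoly ('C(k, j)%:R : {poly F}) * gamma M k P.
    rewrite rmorph_nat mulr_sumr; apply: eq_bigr => v _.
    rewrite mulr_natl -iter_cartierMn; congr (iter v _ _).
    have Ekv : (j * p ^ v + p ^ (v + i0) = k * p ^ v)%N.
      by rewrite expnD mulnC -mulnDr Ek mulnC.
    by rewrite /c Ekv -mulr_natr (bin_mulpX _ _ _ pchar_laurent) mulr_natr.
  apply: contra_not irr => /lrational_polyMl; apply.
  have pcharP : p \in [pchar {poly F}] by rewrite pchar_poly.
  rewrite -(dvdn_pcharf pcharP); apply/(ndvdn_bin p_prime (leq_subr _ _)).
  by rewrite -/j -Ek addKn digit_sumX// Ek dk dj addn1.
apply: (van_der_corput pcharF) => n.
have [h hI] := cform_infinite_index i0M irrc n.
exists h => i i' ii'; pose D := pdiff (h i - h i') P.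
have uD : equid (fun u => res D.[lpoly u]).
  apply: (IH _ j) => //; [exact: size_pdiff| exact: pdiff_support|].
  rewrite (gamma_pdiff _ PM Ps); last exact: esym.
  exact: hI.
apply: (disc_equidistributed_congr pcharF _ (disc_equidistributed_shift (h i') uD)) => u.
rewrite /D horner_pdiff (_ : u + h i' + (h i - h i') = u + h i); last by ring.
rewrite resB subrr.
exact: artin_schreier0.
Qed.

Lemma common_denominator n (g : nat -> laurent F) :
  (forall i, (i < n)%N -> lrational (g i)) ->
  exists2 b : {poly F}, b != 0 & forall i, (i < n)%N ->
    exists u, lpoly b * g i = lpoly u.
Proof.
elim: n => [|n IH] rg; first by exists 1; rewrite ?oner_neq0.
have [|b b0 bg] := IH; first by move=> i ni; apply: rg; exact: ltnW.
have [S [Q [Q0 gn]]] := rg n (ltnSn n).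
exists (b * Q); first by rewrite mulf_neq0.
move=> i; rewrite ltnS leq_eqVlt => /orP[/eqP ->|/bg [u bu]].
  by exists (b * S); rewrite gn !rmorphM -mulrA [lpoly S / _]mulrC mulVKf ?lpoly_eq0.
by exists (Q * u); rewrite !rmorphM /= -bu mulrA [lpoly Q * _]mulrC.
Qed.

(* Only the coefficients of indices [j] with maximal digit sum among those with
   irrational [gamma M j P] matter: above this digit sum the values are periodic. *)
Lemma disc_equidistributed_irrational P M k (a s : {poly F}) : (size P <= M)%N -> (k < M)%N ->
  ~~ (p %| k)%N -> lirrational (gamma M k P) -> a != 0 ->
  equid (fun u => res P.[lpoly (a * u + s)]).
Proof.
move=> PM kM pk irr a0.
pose I := fun j : 'I_M => ~~ (p %| j)%N && `[< lirrational (gamma M j P) >].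
have Ik : I (Ordinal kM) by rewrite /I pk; apply/asboolP.
case: (arg_maxnP (fun j : 'I_M => ds j) Ik) => {k kM pk irr Ik} k.
move=> /andP[pk /asboolP irr] kmax; set sigma := ds k.
have sigma0 : (0 < sigma)%N.
  rewrite lt0n /sigma digit_sum_eq0//; apply: contraNneq pk => ->; exact: dvdn0.
pose P1 := \poly_(r < M) if (ds r <= sigma)%N then P`_r else 0.
pose P2 := \poly_(r < M) if (ds r <= sigma)%N then 0 else P`_r.
have EP : P = P1 + P2.
  apply/polyP => r; rewrite coefD !coef_poly; case: ltnP => Mr.
    by case: ifP; rewrite ?addr0 ?add0r.
  by rewrite nth_default ?addr0// (leq_trans PM).
have P1M : (size P1 <= M)%N by exact: size_poly.
have P2M : (size P2 <= M)%N by exact: size_poly.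
have P1s r : (sigma < ds r)%N -> P1`_r = 0.
  by move=> sr; rewrite coef_poly [(ds r <= _)%N]leqNgt sr /= if_same.
have gamma2 j : gamma M j P2 = if (ds j <= sigma)%N then 0 else gamma M j P.
  have coef2 v : P2`_(j * p ^ v) = if (ds j <= sigma)%N then 0 else P`_(j * p ^ v).
    rewrite coef_poly digit_sumMX//; case: ltnP => // Mj.
    by rewrite nth_default ?if_same// (leq_trans PM).
  case: ifP => js; [apply: big1 => v _|apply: eq_bigr => v _]; rewrite coef2 js//.
  exact: iter_cartier0.
(* Maximality of [sigma] makes these coefficients rational; the value [0] is a placeholder at
   multiples of [p]. *)
have [|b b0 bg] := @common_denominator M (fun j => if (p %| j)%N then 0 else gamma M j P2).
  move=> j jM; case: ifPn => pj; first exact: lrational0.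
  rewrite gamma2; case: leqP => js; first exact: lrational0.
  apply: contrapT => ir; have := kmax (Ordinal jM); rewrite /I pj /=.
  by rewrite leqNgt js => /(_ (asboolT ir)).
apply: (disc_equidistributed_mod b0) => c.
pose c' := a * c + s.
have Ec w : a * (b * w + c) + s = a * b * w + c' by rewrite mulrDr mulrA -addrA.
have M0 : (0 < M)%N by apply: leq_trans (ltn_ord k).
pose C := res P2`_0 + \sum_(j < M | ~~ (p %| j)%N) res (gamma M j P2 * lpoly c' ^+ j).
pose P3 := P1 \Po (lpoly (a * b) *: 'X + (lpoly c')%:P).
have irr3 : lirrational (gamma M k P3).
  (* No other exponent of [P1] contributes at [k * p ^ v], because that would need a digit sum above
     [sigma]. *)
  have -> : gamma M k P3 = lpoly ((a * b) ^+ k) * gamma M k P.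
    rewrite mulr_sumr; apply: eq_bigr => v _.
    rewrite -iter_cartierMX; congr (iter v _ _).
    rewrite -rmorphXn -exprM rmorphXn (coef_comp_linear _ _ _ P1M).
    have dkv : ds (k * p ^ v) = sigma by rewrite digit_sumMX.
    have [kvM|Mkv] := ltnP (k * p ^ v) M; last first.
      rewrite nth_default ?(leq_trans PM)// mulr0 big1// => r _.
      by rewrite bin_small// (leq_trans (ltn_ord r)).
    rewrite (bigD1 (Ordinal kvM))//= big1 ?addr0.
      by rewrite subnn expr0 binn mulr1 mulrC coef_poly kvM dkv leqnn.
    move=> r rkv; apply/eqP/negPn/negP => T0.
    have [kr dr] := mulrn_bin_neq0 T0.
    have rs : (ds r <= sigma)%N.
      by rewrite leqNgt; apply: contra T0 => /P1s ->; rewrite mul0r mul0rn.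
    have : ds (r - k * p ^ v) == 0%N.
      by rewrite -leqn0 -(leq_add2l sigma) -{1}dkv -dr addn0.
    rewrite digit_sum_eq0// subn_eq0 => rk; case/negP: rkv.
    by rewrite -val_eqE /= eqn_leq kr rk.
  apply: contra_not irr => /lrational_polyMl; apply.
  by rewrite expf_neq0// mulf_neq0.
have u3 : equid (fun w => res P3.[lpoly w]).
  apply: (@disc_equidistributed_top_digit_sum sigma.-1 _ M k) => //; rewrite ?prednK//.
    exact: size_comp_linear.
  move=> r sr; rewrite (coef_comp_linear _ _ _ P1M) big1// => r' _.
  apply/eqP/negPn/negP => T0; have [_ dr] := mulrn_bin_neq0 T0.
  have : (ds r' <= sigma)%N.
    by rewrite leqNgt; apply: contra T0 => /P1s ->; rewrite mul0r mul0rn.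
  by rewrite dr leqNgt (leq_trans sr)// leq_addr.
apply: (disc_equidistributed_congr_cst (c := C) _ u3) => w.
rewrite Ec {1}EP hornerD resD.
have -> : P1.[lpoly (a * b * w + c')] = P3.[lpoly w].
  by rewrite /P3 horner_comp hornerD hornerZ hornerX hornerC -rmorphM -rmorphD.
rewrite (_ : _ - _ = res P2.[lpoly (a * b * w + c')] - C); last by ring.
have -> : C = res P2`_0 + \sum_(j < M | ~~ (p %| j)%N)
    res (gamma M j P2 * lpoly (a * b * w + c') ^+ j); last exact: res_horner.
congr (_ + _); apply: eq_bigr => j pj.
have [u Eu] := bg j (ltn_ord j); rewrite (negbTE pj) in Eu.
(* The difference of the two [j]-th powers is divisible by [a * b], so [b] clears the denominator
   and the residue of a polynomial remains, which is zero. *)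
rewrite -!rmorphXn; apply/esym/eqP; rewrite -subr_eq0 -resB -mulrBr -rmorphB subrXX addrK.
by rewrite [a * b]mulrC -!mulrA rmorphM mulrA [gamma _ _ _ * _]mulrC Eu -rmorphM res_poly.
Qed.

End Weyl.

(** * Balls of the torus as cylinders of digits *)

Section Cylinders.
Variables (R : realType) (F : finFieldType).
Implicit Types (a c : laurent F) (x y z : torus F) (n : nat).

(** [Negz i] is [-(i + 1)], so the digits compared are those at [t^-1] down to [t^-n]. *)
Definition same_digits n a c : bool := [forall i : 'I_n, a (Negz i) == c (Negz i)].

Lemma same_digitsP n a c :
  reflect (forall i, (i < n)%N -> a (Negz i) = c (Negz i)) (same_digits n a c).
Proof.
apply: (iffP forallP) => [ac i ni|ac i]; last by rewrite ac.
exact: eqP (ac (Ordinal ni)).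
Qed.

Lemma torus_coef_ge0 x i : 0 <= i -> x i = 0.
Proof. by case: x => a /= /lord_ltP; apply. Qed.

Lemma lcoef_torusB x y i : tor_val (x - y) i = x i - y i.
Proof. by []. Qed.

Lemma lord_same_digits x y n :
  (lord (tor_val (x - y))%R < (- n%:Z)%:E)%E <-> same_digits n x y.
Proof.
split=> [/lord_ltP xy|/same_digitsP xy]; last first.
  apply/lord_ltP => -[i|i] ni; rewrite lcoef_torusB.
    by rewrite !torus_coef_ge0// subrr.
  by rewrite xy ?subrr//; lia.
apply/same_digitsP => i ni; apply/eqP; rewrite -subr_eq0 -lcoef_torusB.
by apply/eqP/xy; lia.
Qed.

Let q_gt1 : 1 < #|F|%:R :> R.
Proof. by rewrite ltr1n card_finNzRing_gt1. Qed.

Let q_gt0 : 0 < #|F|%:R :> R. Proof. exact: lt_trans q_gt1. Qed.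

Lemma torus_ball_digits (c : torus F) (r : R) : 0 < r ->
  exists n, forall x, torus_ball c r x <-> same_digits n x c.
Proof.
move=> r0.
have [n nr] : exists n, #|F|%:R ^- n.+1 < r.
  exists (Num.truncn r^-1).+1; rewrite invf_plt ?posrE ?exprn_gt0//.
  apply: (lt_trans (truncnS_gt _)); rewrite -natrX ltr_nat.
  by apply: (ltn_trans (ltnSn _)); apply: ltn_expl; rewrite card_finNzRing_gt1.
have ex : exists n, #|F|%:R ^- n.+1 < r by exists n.
(* Distances in the torus are [0] or powers [q ^ m] with [m < 0], so the least such [n] describes
   the ball; [n = 0] gives the whole torus. *)
case: (ex_minnP ex) => {nr}n nr nmin; exists n => x.
rewrite -lord_same_digits /torus_ball /=.
have : (lord (tor_val (x - c))%R < 0%:E)%E.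
  by apply/lord_ltP => i i0; rewrite lcoef_torusB !torus_coef_ge0// subrr.
rewrite /labs; case: (lord _) => [m| |] //= m0; last by rewrite ltNyr.
rewrite lte_fin in m0; rewrite lte_fin; split=> [mr|mn].
  rewrite ltNge; apply/negP => nm.
  case: n nm nmin {nr} => [|n] nm nmin; first by lia.
  suff : (n < n)%N by rewrite ltnn.
  apply: nmin; apply: le_lt_trans mr; rewrite exprnN ler_weXz2l ?(ltW q_gt1)//; lia.
apply: le_lt_trans nr; rewrite exprnN ler_weXz2l ?(ltW q_gt1)//; lia.
Qed.

End Cylinders.

(** * The Haar measure of a cylinder *)

Section Haar.
Variables (R : realType) (F : finFieldType).
Variable mu : {measure set (borel_torus F) -> \bar R}.
Hypothesis haar : normalized_haar mu.

Definition cylinder n (c : torus F) : set (borel_torus F) :=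
  [set x : torus F | same_digits n x c].

Lemma measurable_cylinder n c : measurable (cylinder n c).
Proof.
suff oc : torus_open (cylinder n c) by apply: sub_sigma_algebra; exact: oc.
move=> x /same_digitsP xc; exists (- n%:Z) => y.
move=> /lord_same_digits/same_digitsP yx; apply/same_digitsP => i ni.
by rewrite yx// xc.
Qed.

Lemma cylinderE n c :
  cylinder n c = [set c + y | y in (cylinder n 0 : set (torus F))].
Proof.
apply/seteqP; split=> [x /same_digitsP xc|_ [y /same_digitsP y0 <-]].
  exists (x - c); last by rewrite addrC subrK.
  by apply/same_digitsP => i ni; rewrite lcoef_torusB xc// subrr.
by apply/same_digitsP => i ni; rewrite [LHS]/= y0// addr0.
Qed.

(** The torus is a disjoint union of [q ^ n] cylinders, all translates of one another; the fractions
    [v / 'X^n] with [v] of size at most [n] represent them. *)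
Lemma haar_cylinder n c : mu (cylinder n c) = (#|F|%:R ^- n)%:E.
Proof.
have [mu1 mu_trans] := haar.
have muc d : mu (cylinder n d) = mu (cylinder n 0).
  by rewrite cylinderE mu_trans//; exact: measurable_cylinder.
pose T (v : {poly_n F}) : torus F := lfrac (lpoly v / lpoly 'X^n).
have Tv v i : (i < n)%N -> T v (Negz i) = v`_(n - i.+1).
  move=> ni; transitivity ((lpoly v / lpoly 'X^n : laurent F) (Negz i)) => //.
  rewrite (_ : Negz i = (n - i.+1)%N%:Z - n%:Z); last by lia.
  by rewrite -lcoef_lpolyXnM mulrC divfK// lpoly_eq0 -size_poly_eq0 size_polyXn.
have cover : \bigcup_(v in [set: {poly_n F}]) cylinder n (T v) = setT.
  apply/seteqP; split=> // x _.
  exists (mk_npoly n (fun j => x (Negz (n - j.+1)))) => //.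
  apply/same_digitsP => i ni; rewrite Tv//= coef_poly ifT; last by lia.
  by congr (x _); congr Negz; lia.
have triv : trivIset [set: {poly_n F}] (fun v => cylinder n (T v)).
  move=> v w _ _ [x [/same_digitsP xv /same_digitsP xw]].
  apply/npolyP => j; have [jn|nj] := ltnP j n; last by rewrite !big_coef_npoly.
  have jn' : (n - j.+1 < n)%N by lia.
  have := xv _ jn'; rewrite (xw _ jn') !Tv// (_ : (n - (n - j.+1).+1 = j)%N)//.
  by lia.
have := mu1; rewrite -cover measure_fin_bigcup//; first last.
- by move=> v _; exact: measurable_cylinder.
- exact: finite_finset.
have fsumE (f : {poly_n F} -> \bar R) : (\sum_(v \in setT) f v = \sum_v f v)%E.
  rewrite -big_enum /= [RHS]fsbig_seq ?enum_uniq//.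
  congr (\sum_(v \in _) _)%E.
  by apply/seteqP; split=> // v _ /=; rewrite mem_enum.
rewrite fsumE.
have fin0 : mu (cylinder n 0) \is a fin_num.
  rewrite ge0_fin_numE//; apply: (@le_lt_trans _ _ 1%E); last exact: ltry.
  by rewrite -mu1; apply: le_measure; rewrite ?inE//; exact: measurable_cylinder.
rewrite (eq_bigr (fun=> (fine (mu (cylinder n 0)))%:E)); last first.
  by move=> v _; transitivity (mu (cylinder n 0)); [exact: muc|rewrite fineK].
rewrite sumEFin sumr_const (muc c) card_npoly -[_ *+ (_ ^ _)]mulr_natl natrX => -[] E.
have qn0 : #|F|%:R ^+ n != 0 :> R.
  by rewrite expf_neq0// pnatr_eq0 -lt0n ltnW// card_finNzRing_gt1.
by rewrite -(fineK fin0); congr EFin; apply: (mulfI qn0); rewrite E mulfV.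
Qed.

End Haar.

(** * Weyl's criterion and the conclusion *)

Section Equidistribution.
Variables (R : realType) (F : finFieldType) (p : nat).
Hypothesis pcharF : p \in [pchar F].

Lemma avg_count N (P : {poly F} -> bool) :
  #|F|%:R ^- N * #|` fset_set [set u : {poly F} |
    (lord (lpoly u) < N%:Z%:E)%E /\ P u] |%:R = avg N (fun u => (P u)%:R) :> R.
Proof.
congr (_ * _); rewrite -natr_sum; congr _%:R.
pose r : seq {poly F} := [seq val u | u <- enum {poly_N F} & P (val u)].
have -> : [set u : {poly F} | (lord (lpoly u) < N%:Z%:E)%E /\ P u] =
    [set` [fset u in r]%fset].
  apply/seteqP; split=> [u [/lord_ltP uN Pu]|u] /=.
    rewrite !inE; apply/mapP.
    have su : (size u <= N)%N by apply/leq_sizeP => j Nj; exact: (uN j).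
    have uE : val (npolyp N u) = u := npolypK su.
    by exists (npolyp N u); rewrite ?uE// mem_filter mem_enum uE Pu.
  rewrite !inE => /mapP[v]; rewrite mem_filter => /andP[Pv _] ->; split=> //.
  apply/lord_ltP => -[j|j] //= Nj; rewrite nth_default//.
  exact: leq_trans (size_npoly v) _.
rewrite set_fsetK card_fseq undup_id; last first.
  by rewrite (map_inj_uniq val_inj) filter_uniq ?enum_uniq.
by rewrite size_map size_filter -sum1_count big_mkcond big_enum.
Qed.

Local Notation disc := (@disc R F p).

(** Orthogonality for the indicator of a cylinder: if some digit of [a] is nonzero, translating [h]
    by a monomial shifts all residues by an arbitrary [y], and [sum_disc] gives zero. *)
Lemma same_digits_fourier n (a : laurent F) :
  \sum_(h : {poly_n F}) disc (res (lpoly h * a)) =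
  #|F|%:R ^+ n * disc 0 * (same_digits n a 0)%:R.
Proof.
case: same_digitsP => [a0|na].
  rewrite mulr1 (eq_bigr (fun=> disc (0 : F))).
    by rewrite sumr_const card_npoly -[_ *+ (_ ^ _)]mulr_natl natrX.
  move=> h _; congr disc; rewrite /res lcoef_lpolyM big1// => j _.
  rewrite (_ : -1 - j%:Z = Negz j) ?a0 ?mulr0//; last by lia.
  exact: leq_trans (ltn_ord j) (size_npoly h).
have [i ni ai] : exists2 i, (i < n)%N & a (Negz i) != 0.
  apply: contrapT => nex; apply: na => i ni; apply/eqP/negPn/negP => ai.
  by apply: nex; exists i.
rewrite mulr0; set A := \sum_h _.
have Ay y : A = \sum_(h : {poly_n F}) disc (res (lpoly h * a) + y).
  pose e : {poly_n F} := npolyp n ((y / a (Negz i)) *: 'X^i).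
  have ee : e = (y / a (Negz i)) *: 'X^i :> {poly F}.
    by rewrite npolypK// (leq_trans (size_scale_leq _ _))// size_polyXn.
  rewrite /A (reindex_inj (addIr e)); apply: eq_bigr => h _; congr disc.
  rewrite [X in lpoly X](_ : _ = (h : {poly F}) + e)// rmorphD mulrDl resD; congr (_ + _).
  rewrite ee -mul_polyC rmorphM -mulrA /res lcoef_lpolyCM lcoef_lpolyXnM.
  by rewrite (_ : -1 - i%:Z = Negz i) ?divfK//; lia.
have : \sum_(y : F) A = 0.
  rewrite (eq_bigr _ (fun y _ => Ay y)) exchange_big big1// => h _.
  exact: sum_disc.
rewrite sumr_const => /eqP; rewrite mulrn_eq0 => /orP[|/eqP//].
by rewrite -(pnatr_eq0 R) gt_eqF// ltr0n ltnW// card_finNzRing_gt1.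
Qed.

(** In the expansion of the indicator of the ball, [h = 0] gives the measure [q ^- n], and the
    averages for the other [h] tend to zero. *)
Lemma equidistributed_weyl (mu : {measure set (borel_torus F) -> \bar R})
    (g : {poly F} -> laurent F) : normalized_haar mu ->
  (forall h : {poly F}, h != 0 ->
     @disc_equidistributed R F p (fun u => res (lpoly h * g u))) ->
  equidistributed mu g.
Proof.
move=> haar ug c r r0; have [n ballE] := torus_ball_digits c r0.
have -> : mu (torus_ball c r) = (#|F|%:R ^- n)%:E.
  rewrite -(haar_cylinder haar n c); congr (mu _).
  by apply/seteqP; split=> x /ballE.
have -> : (fun N => (#|F|%:R ^- N * #|` fset_set [set u : {poly F} |
      (lord (lpoly u) < N%:Z%:E)%E /\ torus_ball c r (lfrac (g u))] |%:R)%:E) =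
    EFin \o (fun N => avg N (fun u => (same_digits n (g u) c)%:R) : R).
  apply/funext => N /=; congr EFin; rewrite -avg_count.
  congr (_ * (#|` fset_set _|)%:R); apply/seteqP; split=> u [uN /=].
    by move=> /ballE gc; split.
  by move=> gc; split=> //; apply/ballE.
apply: cvg_EFin; first by apply: nearW.
pose D := #|F|%:R ^+ n * disc (0 : F).
have D0 : D != 0.
  rewrite gt_eqF// mulr_gt0 ?(disc0_gt0 _ pcharF)// exprn_gt0//.
  by rewrite ltr0n ltnW// card_finNzRing_gt1.
pose t (h : {poly F}) N : R := avg N (fun u => disc (res (lpoly h * g u) - res (lpoly h * c))).
have fE : (fun N => avg N (fun u => (same_digits n (g u) c)%:R) : R) =
    fun N => D^-1 * (disc 0 + \sum_(h : {poly_n F} | h != 0) t h N).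
  apply/funext => N.
  have gE u : (same_digits n (g u) c)%:R =
      D^-1 * \sum_(h : {poly_n F}) disc (res (lpoly h * g u) - res (lpoly h * c)) :> R.
    have -> : same_digits n (g u) c = same_digits n (g u - c) 0.
      apply/same_digitsP/same_digitsP => gc i /gc; rewrite lcoefB => /eqP.
        by rewrite -subr_eq0 => /eqP.
      by rewrite subr_eq0 => /eqP.
    apply: (mulfI D0); rewrite mulVKf// -same_digits_fourier.
    by apply: eq_bigr => h _; rewrite mulrBr resB.
  rewrite (eq_avg _ gE) avgZ avg_sum (bigD1 0)//=; congr (_ * (_ + _)).
  rewrite -[RHS](avg_cst F N); apply: eq_avg => u.
  transitivity (disc (res (lpoly 0 * g u) - res (lpoly 0 * c))) => //.
  by rewrite rmorph0 !mul0r subrr.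
rewrite fE (_ : _ ^- n = D^-1 * (disc 0 + 0)); last first.
  by rewrite addr0 /D invfM mulfVK// gt_eqF// (disc0_gt0 _ pcharF).
apply: cvgMr; apply: cvgD; first exact: cvg_cst.
by apply: cvg_sum0 => h h0; exact: ug.
Qed.

End Equidistribution.

Theorem theorem1p3 (R : realType) (F : finFieldType) (p : nat)
  (hp : p \in [pchar F])
  (mu : {measure set (borel_torus F) -> \bar R}) (hmu : normalized_haar mu)
  (K : {fset nat}) (hK : 0%N \notin K)
  (alpha : nat -> laurent F)
  (hk : exists k : nat, [/\ k \in K, lirrational (alpha k), ~~ (p %| k)%N &
          forall v : nat, (0 < v)%N -> (p ^ v * k)%N \notin K]) :
  totally_equidistributed mu
    (fun u : {poly F} =>
       \sum_(r <- (0%N |` K)%fset) alpha r * lpoly u ^+ r).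
Proof.
have [k [kK irr pk vK]] := hk.
move=> m s m0; apply: (equidistributed_weyl hp hmu) => h h0.
pose P : {poly laurent F} :=
  \sum_(r <- (0%N |` K)%fset) (lpoly h * alpha r) *: 'X^r.
have PE u : lpoly h * \sum_(r <- (0%N |` K)%fset) alpha r * lpoly u ^+ r =
    P.[lpoly u].
  rewrite horner_sum mulr_sumr; apply: eq_bigr => r _.
  by rewrite hornerZ hornerXn mulrA.
have coefP r : P`_r = if (r \in 0%N |` K)%fset then lpoly h * alpha r else 0.
  rewrite coef_sum (eq_bigr (fun i => if i == r then lpoly h * alpha r else 0)); last first.
    by move=> i _; rewrite coefZ coefXn eq_sym; case: eqP => [->|_]; rewrite ?mulr1 ?mulr0.
  case: ifPn => rK.
    rewrite (bigD1_seq r) ?fset_uniq//= eqxx big1 ?addr0// => i /negbTE -> //.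
  rewrite big_seq big1// => i iK; case: eqP => // ir.
  by rewrite -ir iK in rK.
pose M := (size P + k).+1.
have p_prime := pcharf_prime hp.
have k0 : k != 0%N by apply: contraNneq hK => <-.
have PM : (size P <= M)%N by rewrite /M; lia.
have kM : (k < M)%N by rewrite /M; lia.
(* Since no [p ^ v * k] with [v > 0] lies in [K], nothing merges with the exponent [k], and [gamma]
   reduces to [lpoly h * alpha k]. *)
have irrk : lirrational (gamma hp M k P).
  rewrite /gamma /M big_ord_recl big1 ?addr0.
    rewrite expn0 muln1 coefP in_fset1U kK orbT.
    by apply: contra_not irr; exact: lrational_polyMl.
  move=> v _; have kv : (k * p ^ lift ord0 v)%N \notin K by rewrite mulnC vK.
  have kv0 : (k * p ^ lift ord0 v)%N != 0%N.
    by rewrite -lt0n muln_gt0 lt0n k0 expn_gt0 prime_gt0.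
  rewrite coefP in_fset1U (negbTE kv0) (negbTE kv); exact: (iter_cartier0 hp v.+1).
have uP := disc_equidistributed_irrational (R := R) s PM kM pk irrk m0.
by apply: (disc_equidistributed_congr hp _ uP) => u; rewrite PE subrr artin_schreier0.
Qed.
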